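(* Let $d\ge 1$ be an integer. Every injective function $f\colon \mathrm{sk}_d(\Delta_{2d+2})\to\mathbb{R}^{2d}$ (not assumed continuous) satisfies $\alpha(f)\ge r_{2d-1}=\arccos\left(\frac{-1}{2d}\right)$.
   Context: $\mathrm{sk}_d(\Delta_{2d+2})$ is the $d$-skeleton of the $(2d+2)$-dimensional simplex (geometric realization). For a topological space $X$ and a metric space $Y$, the modulus of discontinuity of a function $g\colon X\to Y$ is $\delta(g)=\inf\{\delta\ge 0 : \text{for every } x\in X \text{ there is an open neighborhood } U_x \text{ of } x \text{ with } \operatorname{diam}(g(U_x))\le\delta\}$. The unit sphere $S^{m-1}$ carries the geodesic metric $d(u,v)=\arccos\langle u,v\rangle$. For a topological space $X$, $\mathrm{Conf}_2(X)=\{(x,y)\in X\times X: x\neq y\}$ with the subspace topology. For an injective function $f\colon X\to\mathbb{R}^m$, define $\Phi_f\colon \mathrm{Conf}_2(X)\to S^{m-1}$ by $\Phi_f(x,y)=\frac{f(x)-f(y)}{\|f(x)-f(y)\|}$ and $\alpha(f)=\delta(\Phi_f)$. For $n\ge 0$, $r_n=\arccos\left(\frac{-1}{n+1}\right)$. *)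

(* Defs.v *)
From Stdlib Require Import Reals List Lra Lia.
From Coquelicot Require Import Coquelicot.
Open Scope R_scope.

Fixpoint rsum (m : nat) (f : nat -> R) : R :=
  match m with O => 0 | S k => rsum k f + f k end.

Definition Rvec (m : nat) : Type :=
  { v : nat -> R | forall i, (m <= i)%nat -> v i = 0 }.

Definition inner (m : nat) (u v : nat -> R) : R := rsum m (fun i => u i * v i).
Definition norm (m : nat) (u : nat -> R) : R := sqrt (inner m u u).
Definition vsub (u v : nat -> R) : nat -> R := fun i => u i - v i.
Definition vscal (c : R) (u : nat -> R) : nat -> R := fun i => c * u i.

Definition sphere_dist (m : nat) (u v : nat -> R) : R := acos (inner m u v).

(** Geometric realization of the d-skeleton of the n-simplex Δ_n, as the
    subspace of R^{n+1} of points of the standard simplex conv(e_0,...,e_n)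
    lying in some face spanned by at most d+1 vertices. *)
Definition in_skel (d n : nat) (x : nat -> R) : Prop :=
  (forall i, (n + 1 <= i)%nat -> x i = 0) /\
  (forall i, 0 <= x i) /\
  rsum (n + 1) x = 1 /\
  exists s : list nat, (length s <= d + 1)%nat /\
                       forall i, ~ In i s -> x i = 0.

Definition skel (d n : nat) : Type := { x : nat -> R | in_skel d n x }.

Definition skel_dist (d n : nat) (x y : skel d n) : R :=
  norm (n + 1) (vsub (proj1_sig x) (proj1_sig y)).

Definition Conf2 (X : Type) : Type := { p : X * X | fst p <> snd p }.

(** Open sets of Conf_2(sk_d(Δ_n)) for the subspace topology of the
    product topology on X × X (product of the metric topologies). *)
Definition conf_open (d n : nat) (U : Conf2 (skel d n) -> Prop) : Prop :=
  forall q, U q -> exists e, 0 < e /\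
    forall q', skel_dist d n (fst (proj1_sig q)) (fst (proj1_sig q')) < e ->
               skel_dist d n (snd (proj1_sig q)) (snd (proj1_sig q')) < e ->
               U q'.

Definition diam_img {T : Type} (m : nat) (g : T -> nat -> R) (U : T -> Prop) : Rbar :=
  Lub_Rbar (fun r => exists u v, U u /\ U v /\ r = sphere_dist m (g u) (g v)).

Definition mod_discont {T : Type} (op : (T -> Prop) -> Prop) (m : nat)
  (g : T -> nat -> R) : Rbar :=
  Glb_Rbar (fun δ => 0 <= δ /\
     forall x : T, exists U : T -> Prop, op U /\ U x /\ Rbar_le (diam_img m g U) δ).

Definition Phi {X : Type} (m : nat) (f : X -> Rvec m) (p : Conf2 X) : nat -> R :=
  let w := vsub (proj1_sig (f (fst (proj1_sig p)))) (proj1_sig (f (snd (proj1_sig p)))) in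
  vscal (/ norm m w) w.

Definition alpha (d n m : nat) (f : skel d n -> Rvec m) : Rbar :=
  mod_discont (conf_open d n) m (Phi m f).

Definition r_ (n : nat) : R := acos (-1 / INR (n + 1)).

(* Main.v *)
Require Import Defs.
From Stdlib Require Import Reals List Lra Lia Bool Sorted Classical.
From Stdlib Require Import ClassicalEpsilon FunctionalExtensionality.
From Stdlib Require Import ProofIrrelevance.
From Coquelicot Require Import Coquelicot.
Import ListNotations.
Open Scope R_scope.

(** Suppose that [Phi_f] has local oscillation at most [delta < r_(2d-1)].
    Subtracting from [z] in [R^(2d+3)] its median leaves a positive and a
    negative part which are disjointly supported and, once normalised, lie in
    the [d]-skeleton. So [z] defines a configuration [(x, y)], and sending [z]
    to [Phi_f (x, y)] together with the difference of the masses of the two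
    parts is an odd, discontinuous map from the sphere [S^(2d+1)], taken in the
    hyperplane of vanishing last coordinate, to [R^(2d+1)].

    A discrete Borsuk-Ulam theorem gives arbitrarily small simplices for which
    the convex hull of the values at the vertices comes arbitrarily close to
    [0]. It is obtained by subdividing the hemispheres of the octahedron until
    they are small, lifting the vertices to their values, subdividing again in
    the target, and counting alternating simplices as Ky Fan does. On such a
    simplex both masses are bounded below, so by compactness the values of
    [Phi_f] at its vertices are unit vectors of [R^(2d)] with pairwise angles at
    most [delta]. By Carathéodory's theorem a point of their hull is a
    combination of [2d+1] of them, and its squared norm is at least
    [(2d cos delta + 1) / (2d + 1) > 0], a contradiction. *)

(** * Chains modulo 2 and alternating simplices *)

(** A single vertex has the empty list as its only face, so [boundary] is the augmented boundary. *)
Fixpoint faces {A : Type} (s : list A) : list (list A) :=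
  match s with
  | [] => []
  | x :: t => t :: map (cons x) (faces t)
  end.

Definition boundary {A : Type} (C : list (list A)) : list (list A) :=
  flat_map faces C.

Fixpoint xsum {A : Type} (phi : A -> bool) (C : list A) : bool :=
  match C with
  | [] => false
  | s :: D => xorb (phi s) (xsum phi D)
  end.

(** Equality of the formal sums modulo 2. *)
Definition ceq {A : Type} (C D : list A) : Prop :=
  forall phi, xsum phi C = xsum phi D.

Lemma xsum_app {A} (phi : A -> bool) C D :
  xsum phi (C ++ D) = xorb (xsum phi C) (xsum phi D).
Proof.
  induction C as [|s C IH]; simpl; [now destruct (xsum phi D)|].
  now rewrite IH, xorb_assoc.
Qed.

Lemma xsum_map {A B} (phi : B -> bool) (g : A -> B) C :
  xsum phi (map g C) = xsum (fun s => phi (g s)) C.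
Proof. induction C as [|s C IH]; simpl; congruence. Qed.

Lemma xsum_flat_map {A B} (phi : B -> bool) (g : A -> list B) C :
  xsum phi (flat_map g C) = xsum (fun s => xsum phi (g s)) C.
Proof. induction C as [|s C IH]; simpl; [easy|]. now rewrite xsum_app, IH. Qed.

Lemma xsum_ext {A} (phi psi : A -> bool) C :
  (forall s, In s C -> phi s = psi s) -> xsum phi C = xsum psi C.
Proof.
  induction C as [|s C IH]; simpl; intros H; [easy|].
  rewrite (H s), IH; auto.
Qed.

Lemma xsum_xorb {A} (phi psi : A -> bool) C :
  xsum (fun s => xorb (phi s) (psi s)) C = xorb (xsum phi C) (xsum psi C).
Proof.
  induction C as [|s C IH]; simpl; [easy|]. rewrite IH.
  destruct (phi s), (psi s), (xsum phi C), (xsum psi C); reflexivity.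
Qed.

Lemma xsum_true {A} (phi : A -> bool) C :
  xsum phi C = true -> exists s, In s C /\ phi s = true.
Proof.
  induction C as [|s C IH]; simpl; [easy|]. intros H.
  destruct (phi s) eqn:E; [now exists s; auto|].
  destruct (IH H) as [t [Ht1 Ht2]]. exists t; auto.
Qed.

Lemma ceq_flat_map {A B} (g : A -> list B) C D :
  ceq C D -> ceq (flat_map g C) (flat_map g D).
Proof. intros H phi. rewrite !xsum_flat_map. apply H. Qed.

Lemma ceq_map {A B} (g : A -> B) C D : ceq C D -> ceq (map g C) (map g D).
Proof. intros H phi. rewrite !xsum_map. apply H. Qed.

Lemma faces_map {A B} (g : A -> B) s :
  faces (map g s) = map (map g) (faces s).
Proof.
  induction s as [|x s IH]; simpl; [easy|].
  rewrite IH, !map_map. reflexivity.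
Qed.

Lemma boundary_map {A B} (g : A -> B) C :
  boundary (map (map g) C) = map (map g) (boundary C).
Proof.
  induction C as [|s C IH]; simpl; [easy|].
  now rewrite faces_map, IH, map_app.
Qed.

Lemma faces_length {A} (s t : list A) :
  In t (faces s) -> length s = S (length t).
Proof.
  revert t. induction s as [|x s IH]; simpl; [easy|].
  intros t [<-|H]; [easy|]. apply in_map_iff in H.
  destruct H as [t' [<- H]]. simpl. now rewrite (IH _ H).
Qed.

Lemma faces_incl {A} (s t : list A) : In t (faces s) -> incl t s.
Proof.
  revert t. induction s as [|x s IH]; simpl; [easy|].
  intros t [<-|H] y Hy; [now right|]. apply in_map_iff in H.
  destruct H as [t' [<- H]]. destruct Hy as [->|Hy]; [now left|].
  right. eapply IH; eauto.
Qed.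

(** Cone formula: the faces of a cone are its base and the cones over the faces of its base. *)
Lemma xsum_boundary_cons {A} (phi : list A -> bool) x C :
  xsum phi (boundary (map (cons x) C)) =
  xorb (xsum phi C) (xsum (fun t => phi (x :: t)) (boundary C)).
Proof.
  unfold boundary. rewrite !xsum_flat_map, xsum_map, <- xsum_xorb.
  apply xsum_ext. intros s _. simpl. now rewrite xsum_map.
Qed.

(** By the cone formula [faces s] occurs twice and cancels. What remains is a cone over a double
    boundary, zero by induction. *)
Lemma boundary_faces {A} (s : list A) : ceq (boundary (faces s)) [].
Proof.
  induction s as [|x s IH]; intros phi; [easy|].
  change (boundary (faces (x :: s)))
    with (faces s ++ boundary (map (cons x) (faces s))).
  rewrite xsum_app, xsum_boundary_cons, (IH (fun t => phi (x :: t))).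
  simpl. now rewrite xorb_false_r, xorb_nilpotent.
Qed.

Definition vneg (u : nat -> R) : nat -> R := fun i => - u i.

Lemma vneg_involutive u : vneg (vneg u) = u.
Proof. apply functional_extensionality; intro i. apply Ropp_involutive. Qed.

(** The chain-level shadow of the hemispheres of the antipodal sphere. *)
Definition hemispheres (C : nat -> list (list (nat -> R))) : Prop :=
  (exists v, C 0%nat = [[v]]) /\
  forall k, ceq (boundary (C (S k))) (C k ++ map (map vneg) (C k)).

(** * Alternating sign sequences and labels sorted by index *)

Fixpoint alt (b : bool) (l : list bool) : bool :=
  match l with
  | [] => true
  | x :: t => eqb b x && alt (negb b) t
  end.

Lemma xsum_false {A} (C : list A) : xsum (fun _ => false) C = false.
Proof. induction C; simpl; auto. Qed.

(** In an alternating list, deleting an interior entry creates equal neighbours, so only end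
    deletions count, and exactly one of them gives first sign [b]. A list that does not alternate
    but has an alternating face has exactly one pair of equal neighbours; deleting either gives the
    same face, and the two cancel. *)
Lemma xsum_alt_faces b l :
  xsum (alt b) (faces l) = xorb (alt b l) (alt (negb b) l).
Proof.
  revert b. induction l as [|x l IH]; intros b; [now destruct b|].
  destruct b, x; simpl; rewrite xsum_map; simpl; rewrite ?xsum_false;
  try (change (fun s => alt ?c s) with (alt c); rewrite IH; simpl);
  destruct (alt true l), (alt false l); reflexivity.
Qed.

Lemma alt_negb b l : alt b (map negb l) = alt (negb b) l.
Proof.
  revert b. induction l as [|x l IH]; intros b; [easy|].
  simpl. rewrite IH. now destruct b, x.
Qed.

Definition label : Type := (nat * bool)%type.

Definition key_le (p q : label) : Prop := (fst p <= fst q)%nat.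

Definition flip (p : label) : label := (fst p, negb (snd p)).

Fixpoint insert (x : label) (l : list label) : list label :=
  match l with
  | [] => [x]
  | y :: t => if (fst x <=? fst y)%nat then x :: l else y :: insert x t
  end.

Fixpoint isort (l : list label) : list label :=
  match l with
  | [] => []
  | x :: t => insert x (isort t)
  end.

Lemma In_insert x y l : In y (insert x l) <-> y = x \/ In y l.
Proof.
  induction l as [|z l IH]; simpl; [intuition|].
  destruct (fst x <=? fst z)%nat; simpl; [|rewrite IH]; intuition.
Qed.

Lemma In_isort y l : In y (isort l) <-> In y l.
Proof.
  induction l as [|x l IH]; simpl; [easy|].
  rewrite In_insert, IH. intuition.
Qed.

Lemma insert_length x l : length (insert x l) = S (length l).
Proof.
  induction l as [|y l IH]; simpl; [easy|].
  destruct (fst x <=? fst y)%nat; simpl; congruence.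
Qed.

Lemma isort_length l : length (isort l) = length l.
Proof. induction l; simpl; [easy|]. rewrite insert_length; congruence. Qed.

Lemma isort_sorted l : StronglySorted key_le (isort l).
Proof.
  induction l as [|x l IH]; simpl; [constructor|].
  induction IH as [|y m Hm IHm Hy]; simpl; [repeat constructor|].
  destruct (fst x <=? fst y)%nat eqn:E.
  - apply Nat.leb_le in E. constructor; [now constructor|].
    constructor; [exact E|]. revert Hy. apply Forall_impl.
    unfold key_le. intros; lia.
  - apply Nat.leb_gt in E. constructor; [exact IHm|].
    apply Forall_forall. intros z Hz. apply In_insert in Hz.
    destruct Hz as [->|Hz]; [unfold key_le; lia|].
    rewrite Forall_forall in Hy. auto.
Qed.

Lemma insert_le x l : List.Forall (key_le x) l -> insert x l = x :: l.
Proof.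
  destruct 1 as [|y l Hy]; simpl; [easy|].
  now rewrite (proj2 (Nat.leb_le _ _) Hy).
Qed.

(** A face of [insert x l] either drops [x] or inserts [x] into a face of [l]. Sortedness is used
    when [x] goes to the front: it must also go to the front of every face. *)
Lemma xsum_faces_insert phi x l :
  StronglySorted key_le l ->
  xsum phi (faces (insert x l)) =
  xorb (phi l) (xsum (fun t => phi (insert x t)) (faces l)).
Proof.
  intros H. revert phi. induction H as [|y l Hl IH Hy]; intros phi; [easy|].
  simpl insert. destruct (fst x <=? fst y)%nat eqn:E.
  - apply Nat.leb_le in E. change (faces (x :: y :: l))
      with ((y :: l) :: map (cons x) (faces (y :: l))).
    cbn [xsum]. f_equal. rewrite xsum_map. apply xsum_ext.
    intros t Ht. rewrite insert_le; [easy|]. apply Forall_forall.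
    intros z Hz. apply (faces_incl _ _ Ht) in Hz.
    destruct Hz as [<-|Hz]; [exact E|].
    rewrite Forall_forall in Hy. specialize (Hy z Hz).
    unfold key_le in *. lia.
  - simpl. rewrite !xsum_map, (IH (fun t => phi (y :: t))).
    simpl. rewrite E.
    destruct (phi (insert x l)), (phi (y :: l)); simpl; try easy;
    now rewrite ?negb_involutive.
Qed.

Lemma faces_isort l : ceq (faces (isort l)) (map isort (faces l)).
Proof.
  induction l as [|x l IH]; intros phi; [easy|].
  simpl. rewrite (xsum_faces_insert _ _ _ (isort_sorted l)), IH.
  now rewrite !xsum_map.
Qed.

(** The order compares indices only, so reversing all signs does not affect it. *)
Lemma isort_flip l : isort (map flip l) = map flip (isort l).
Proof.
  assert (H : forall x m, insert (flip x) (map flip m) = map flip (insert x m)).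
  { intros x m. induction m as [|y m IH]; simpl; [easy|].
    destruct (fst x <=? fst y)%nat; simpl; congruence. }
  induction l as [|x l IH]; simpl; [easy|]. now rewrite IH, H.
Qed.

(** Neighbours of equal index carry opposite signs and form the desired pair. Otherwise the indices
    increase strictly, and fewer than [length l] values are available. *)
Lemma alt_sorted_complementary N b l :
  StronglySorted key_le l -> alt b (map snd l) = true ->
  (forall p, In p l -> (fst p < N)%nat) -> (N < length l)%nat ->
  exists i, In (i, true) l /\ In (i, false) l.
Proof.
  destruct l as [|x l]; [simpl; lia|]. intros S A F L.
  assert (H : (exists i, In (i, true) (x :: l) /\ In (i, false) (x :: l)) \/
              (fst x + length (x :: l) <= N)%nat); [|intuition lia].
  clear L. revert b x S A F. induction l as [|y l IH]; intros b x S A F.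
  - right. specialize (F x (or_introl eq_refl)). simpl; lia.
  - apply StronglySorted_inv in S. destruct S as [S1 S2].
    simpl in A. apply andb_prop in A. destruct A as [A1 A2].
    destruct (IH (negb b) y S1 A2) as [[i Hi]|H].
    + intros p Hp. apply F. now right.
    + left. exists i. simpl in *; tauto.
    + inversion_clear S2 as [|? ? Hxy _]. unfold key_le in Hxy.
      destruct (Nat.eq_dec (fst x) (fst y)) as [E|E]; [|right; simpl in *; lia].
      left. exists (fst x). destruct x as [i s], y as [j t]; simpl in *; subst j.
      apply andb_prop in A2. destruct A2 as [A2 _].
      destruct b, s, t; try easy; auto.
Qed.

(** Ky Fan's parity argument: in every dimension the hemisphere has an odd
    number of simplices whose signs alternate once sorted by index. *)
Lemma complementary_pair C N (lab : (nat -> R) -> label) :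
  hemispheres C ->
  (forall k s w, (k <= N)%nat -> In s (C k) -> In w s ->
     lab (vneg w) = flip (lab w) /\ (fst (lab w) < N)%nat) ->
  (forall s, In s (C N) -> length s = S N) ->
  exists s w w' i, In s (C N) /\ In w s /\ In w' s /\
    lab w = (i, true) /\ lab w' = (i, false).
Proof.
  intros [[v C0] CS] G L.
  set (a := fun b s => alt b (map snd (isort (map lab s)))).
  (* Modulo 2 the faces of the sorted label list are the sorted label lists of the faces, so the
     count for sign sequences transfers to simplices. *)
  assert (Hd : forall s, xsum (a true) (faces s) = xorb (a true s) (a false s)).
  { intros s. unfold a at 2 3. rewrite <- (xsum_alt_faces true).
    rewrite faces_map, xsum_map, faces_isort, xsum_map, faces_map, xsum_map.
    reflexivity. }
  assert (Hn : forall k s, (k <= N)%nat -> In s (C k) ->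
            a true (map vneg s) = a false s).
  { intros k s Hk Hs. unfold a.
    assert (E : map lab (map vneg s) = map flip (map lab s)).
    { rewrite !map_map. apply map_ext_in. intros w Hw. eapply G; eauto. }
    rewrite E, isort_flip, map_map.
    change (alt true (map (fun p : label => negb (snd p))
      (isort (map lab s))) = alt false (map snd (isort (map lab s)))).
    rewrite <- (map_map (@snd nat bool) negb). apply alt_negb. }
  (* Counting positive alternating faces over a hemisphere reduces to its boundary: the lower
     hemisphere and its antipode. Those of the antipode match the negative ones of the lower
     hemisphere, so the parity is the same in all dimensions. A single vertex alternates in exactly
     one way. *)
  assert (Hodd : forall k, (k <= N)%nat ->
            xsum (fun s => xorb (a true s) (a false s)) (C k) = true).
  { induction k as [|k IH]; intros Hk.
    - rewrite C0. simpl. unfold a. simpl. now destruct (snd (lab v)).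
    - etransitivity; [|apply IH; lia].
      rewrite (xsum_ext _ (fun s => xsum (a true) (faces s)))
        by (intros; symmetry; apply Hd).
      rewrite <- xsum_flat_map. fold (boundary (C (S k))).
      rewrite CS, xsum_app, xsum_xorb. f_equal.
      rewrite xsum_map. apply xsum_ext. intros s Hs. apply (Hn k); auto; lia. }
  destruct (xsum_true _ _ (Hodd N (le_n N))) as [s [Hs Ha]].
  assert (Hb : exists b, a b s = true).
  { destruct (a true s) eqn:E; [now exists true|now exists false]. }
  destruct Hb as [b Hb].
  destruct (alt_sorted_complementary N b (isort (map lab s))) as [i [H1 H2]].
  - apply isort_sorted.
  - exact Hb.
  - intros p Hp. apply (proj1 (In_isort _ _)), in_map_iff in Hp.
    destruct Hp as [w [<- Hw]]. eapply (G N); eauto.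
  - rewrite isort_length, length_map, L; auto.
  - apply (proj1 (In_isort _ _)), in_map_iff in H1, H2.
    destruct H1 as [w [E1 H1]], H2 as [w' [E2 H2]].
    exists s, w, w', i. auto.
Qed.

(** * Barycentric subdivision *)

Definition vsum (s : list (nat -> R)) : nat -> R :=
  fun i => fold_right (fun p acc => p i + acc) 0 s.

Definition bary (s : list (nat -> R)) : nat -> R :=
  fun i => vsum s i / INR (length s).

(** Barycentric subdivision; [n] is the fuel and must be [length s]. *)
Fixpoint sd (n : nat) (s : list (nat -> R)) : list (list (nat -> R)) :=
  match n with
  | O => [[]]
  | S k => map (cons (bary s)) (flat_map (sd k) (faces s))
  end.

Definition subdivide (C : nat -> list (list (nat -> R))) (k : nat) :=
  flat_map (sd (S k)) (C k).

Lemma bary_vneg s : bary (map vneg s) = vneg (bary s).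
Proof.
  apply functional_extensionality; intros i. unfold bary.
  rewrite length_map. unfold vneg at 2.
  replace (vsum (map vneg s) i) with (- vsum s i).
  - unfold Rdiv. ring.
  - unfold vsum. induction s as [|p s IH]; simpl; [ring|].
    rewrite <- IH. unfold vneg. ring.
Qed.

Lemma flat_map_map {A B D} (g : A -> B) (h : B -> list D) l :
  flat_map h (map g l) = flat_map (fun x => h (g x)) l.
Proof. induction l; simpl; congruence. Qed.

Lemma map_flat_map {A B D} (g : B -> D) (h : A -> list B) l :
  map g (flat_map h l) = flat_map (fun x => map g (h x)) l.
Proof. induction l; simpl; [easy|]. rewrite map_app; congruence. Qed.

Lemma sd_vneg n s : sd n (map vneg s) = map (map vneg) (sd n s).
Proof.
  revert s. induction n as [|n IH]; intros s; [easy|]. simpl.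
  rewrite bary_vneg, faces_map, flat_map_map, (flat_map_ext _ _ IH).
  rewrite <- map_flat_map, !map_map. reflexivity.
Qed.

Lemma boundary_flat_map {A B} (g : A -> list (list B)) C :
  boundary (flat_map g C) = flat_map (fun s => boundary (g s)) C.
Proof.
  unfold boundary. induction C as [|s C IH]; simpl; [easy|].
  now rewrite flat_map_app, IH.
Qed.

Lemma flat_map_boundary {A B} (g : list A -> list B) C :
  flat_map g (boundary C) = flat_map (fun t => flat_map g (faces t)) C.
Proof.
  unfold boundary. induction C as [|s C IH]; simpl; [easy|].
  now rewrite flat_map_app, IH.
Qed.

(** Subdivision is a chain map: [sd] is the cone from the barycentre over the subdivided boundary,
    and by induction the boundary of that base is a subdivided double boundary, hence zero. *)
Lemma boundary_sd n s :
  length s = n -> ceq (boundary (sd n s)) (flat_map (sd (pred n)) (faces s)).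
Proof.
  revert s. induction n as [|n IH]; intros s Hs phi.
  - destruct s; [reflexivity|discriminate].
  - simpl sd. rewrite xsum_boundary_cons. simpl pred.
    replace (xsum _ (boundary _)) with false; [apply xorb_false_r|]. symmetry.
    rewrite boundary_flat_map, xsum_flat_map.
    erewrite xsum_ext.
    2: { intros t Ht. apply (IH t). apply faces_length in Ht. lia. }
    rewrite <- (xsum_flat_map _ (fun t => flat_map (sd (pred n)) (faces t))).
    replace (flat_map _ (faces s))
      with (flat_map (sd (pred n)) (boundary (faces s))).
    + rewrite (ceq_flat_map _ _ _ (boundary_faces s)). reflexivity.
    + apply flat_map_boundary.
Qed.

Lemma subdivide_hemispheres C :
  hemispheres C -> (forall k s, In s (C k) -> length s = S k) ->
  hemispheres (subdivide C).
Proof.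
  intros [[v C0] CS] L. split.
  - exists (bary [v]). unfold subdivide. now rewrite C0.
  - intros k phi. unfold subdivide at 1. rewrite boundary_flat_map, xsum_flat_map.
    erewrite xsum_ext.
    2: { intros t Ht. apply boundary_sd. now apply L. }
    rewrite <- (xsum_flat_map _ (fun t => flat_map (sd (S k)) (faces t))).
    replace (flat_map _ (C (S k)))
      with (flat_map (sd (S k)) (boundary (C (S k)))).
    + rewrite (ceq_flat_map _ _ _ (CS k)), flat_map_app. unfold subdivide.
      rewrite !xsum_app. f_equal. rewrite flat_map_map.
      rewrite (flat_map_ext _ _ (sd_vneg (S k))), map_flat_map. reflexivity.
    + apply flat_map_boundary.
Qed.

(** The relations concern lists of vertices, so any odd map preserves them, however discontinuous;
    image simplices may be degenerate. *)
Lemma map_hemispheres C (G : (nat -> R) -> nat -> R) :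
  (forall p, G (vneg p) = vneg (G p)) ->
  hemispheres C -> hemispheres (fun k => map (map G) (C k)).
Proof.
  intros HG [[v C0] CS]. split.
  - exists (G v). now rewrite C0.
  - intros k phi. rewrite boundary_map, (ceq_map _ _ _ (CS k)), map_app.
    rewrite !xsum_app. f_equal. rewrite !map_map. f_equal.
    apply map_ext. intros s. rewrite !map_map. now apply map_ext.
Qed.

Lemma sd_length n s t : In t (sd n s) -> length t = n.
Proof.
  revert s t. induction n as [|n IH]; simpl; intros s t H.
  - now destruct H as [<-|[]].
  - apply in_map_iff in H. destruct H as [t' [<- H]]. simpl. f_equal.
    apply in_flat_map in H. destruct H as [u [_ H]]. eauto.
Qed.

(** Closure under barycentres, with repetitions allowed, is exactly what passing to the vertices of
    a subdivision requires. *)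
Definition avg_closed (Q : (nat -> R) -> Prop) : Prop :=
  forall s, s <> [] -> (forall p, In p s -> Q p) -> Q (bary s).

Lemma sd_avg_closed Q n s t :
  avg_closed Q -> length s = n -> (forall p, In p s -> Q p) ->
  In t (sd n s) -> forall p, In p t -> Q p.
Proof.
  intros HQ. revert s t. induction n as [|n IH]; simpl; intros s t L Hs H p Hp.
  - now destruct H as [<-|[]].
  - apply in_map_iff in H. destruct H as [t' [<- H]]. destruct Hp as [<-|Hp].
    + apply HQ; [|exact Hs]. now intros ->.
    + apply in_flat_map in H. destruct H as [u [Hu H]]. apply (IH u t'); auto.
      * apply faces_length in Hu. lia.
      * intros q Hq. apply Hs. eapply faces_incl; eauto.
Qed.

Lemma INR_length_pos {A} (s : list A) : s <> [] -> 0 < INR (length s).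
Proof. destruct s; [easy|]. intros _. apply lt_0_INR. simpl; lia. Qed.

Lemma avg_closed_le i b : avg_closed (fun p => p i <= b).
Proof.
  intros s Hs H. unfold bary. apply INR_length_pos in Hs.
  apply Rle_div_l; [exact Hs|]. clear Hs. unfold vsum.
  induction s as [|p s IH]; simpl fold_right; [simpl; lra|].
  simpl length. rewrite S_INR.
  assert (p i <= b) by (apply H; now left).
  assert (fold_right (fun p acc => p i + acc) 0 s <= b * INR (length s))
    by (apply IH; intros; apply H; now right). lra.
Qed.

Lemma avg_closed_ge i b : avg_closed (fun p => b <= p i).
Proof.
  intros s Hs H.
  assert (K : bary (map vneg s) i <= - b).
  { apply (avg_closed_le i (- b)); [now destruct s|].
    intros p Hp. apply in_map_iff in Hp. destruct Hp as [q [<- Hq]].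
    specialize (H q Hq). unfold vneg. lra. }
  rewrite bary_vneg in K. unfold vneg in K. lra.
Qed.

Lemma vsum_spread s i a D :
  In a s -> (forall p, In p s -> p i - a i <= D) -> 0 <= D ->
  vsum s i <= INR (length s) * a i + (INR (length s) - 1) * D.
Proof.
  intros Ha H HD. unfold vsum. induction s as [|p s IH]; [easy|].
  simpl fold_right. simpl length. rewrite S_INR.
  assert (Hall : fold_right (fun p acc => p i + acc) 0 s
                 <= INR (length s) * (a i + D)).
  { clear Ha IH. assert (H' : forall q, In q s -> q i - a i <= D)
      by (intros; apply H; now right). clear H.
    induction s as [|q s IHs]; simpl fold_right; [simpl; lra|].
    simpl length. rewrite S_INR.
    assert (q i - a i <= D) by (apply H'; now left).
    assert (fold_right (fun p acc => p i + acc) 0 s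
                 <= INR (length s) * (a i + D))
      by (apply IHs; intros; apply H'; now right). lra. }
  destruct Ha as [<-|Ha]; [lra|].
  assert (p i - a i <= D) by (apply H; now left).
  assert (fold_right (fun p acc => p i + acc) 0 s <=
    INR (length s) * a i + (INR (length s) - 1) * D)
    by (apply IH; auto; intros; apply H; now right). lra.
Qed.

(** The entry [a] contributes zero to the average of the differences [p i - a i]. For [n] entries
    this gives the factor [(n - 1) / n], which increases with [n]. *)
Lemma bary_spread s i a D M :
  In a s -> (forall p, In p s -> p i - a i <= D) -> 0 <= D ->
  (length s <= S M)%nat ->
  bary s i - a i <= INR M / INR (S M) * D.
Proof.
  intros Ha H HD HM.
  assert (P : 0 < INR (length s)) by (apply INR_length_pos; now intros ->).
  assert (L : INR (length s) <= INR (S M)) by now apply le_INR.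
  pose proof (vsum_spread s i a D Ha H HD) as K.
  unfold bary. rewrite S_INR in *.
  apply Rle_trans with ((1 - / INR (length s)) * D).
  - apply Rmult_le_reg_r with (INR (length s)); [exact P|].
    replace ((vsum s i / INR (length s) - a i) * INR (length s))
      with (vsum s i - INR (length s) * a i) by (field; lra).
    replace ((1 - / INR (length s)) * D * INR (length s))
      with ((INR (length s) - 1) * D) by (field; lra). lra.
  - apply Rmult_le_compat_r; [exact HD|].
    replace (INR M / (INR M + 1)) with (1 - / (INR M + 1)) by (field; lra).
    assert (/ (INR M + 1) <= / INR (length s)) by (apply Rinv_le_contravar; lra).
    lra.
Qed.

(** The classical mesh estimate, one coordinate at a time: a pair of vertices either involves the
    barycentre of [s] or lies in the subdivision of a face. *)
Lemma sd_spread i D M n s t :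
  length s = n -> (n <= S M)%nat ->
  (forall p q, In p s -> In q s -> p i - q i <= D) ->
  In t (sd n s) ->
  forall p q, In p t -> In q t -> p i - q i <= INR M / INR (S M) * D.
Proof.
  revert s t. induction n as [|n IH]; intros s t L HM H Ht p q Hp Hq.
  - destruct Ht as [<-|[]]. easy.
  - assert (HD : 0 <= D).
    { destruct s as [|x s]; [easy|].
      specialize (H x x (or_introl eq_refl) (or_introl eq_refl)). lra. }
    simpl in Ht. apply in_map_iff in Ht. destruct Ht as [t' [<- Ht]].
    apply in_flat_map in Ht. destruct Ht as [u [Hu Ht]].
    assert (Lu : length u = n) by (apply faces_length in Hu; lia).
    assert (up : forall a, In a s -> bary s i - a i <= INR M / INR (S M) * D).
    { intros a Ha. apply bary_spread; auto; lia. }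
    (* The lower estimate is the upper one for the antipodal list. *)
    assert (dn : forall a, In a s -> a i - bary s i <= INR M / INR (S M) * D).
    { intros a Ha.
      assert (K : bary (map vneg s) i - vneg a i <= INR M / INR (S M) * D).
      { apply bary_spread; auto.
        - now apply in_map.
        - intros b Hb. apply in_map_iff in Hb. destruct Hb as [b' [<- Hb]].
          unfold vneg. specialize (H a b' Ha Hb). lra.
        - rewrite length_map. lia. }
      rewrite bary_vneg in K. unfold vneg in K. lra. }
    assert (In_t' : forall a, In a t' ->
        bary s i - INR M / INR (S M) * D <= a i <=
        bary s i + INR M / INR (S M) * D).
    { intros a Ha. split.
      - apply (sd_avg_closed _ n u t' (avg_closed_ge i _) Lu) with (p := a); auto.
        intros b Hb. apply (faces_incl _ _ Hu) in Hb. specialize (up b Hb). lra.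
      - apply (sd_avg_closed _ n u t' (avg_closed_le i _) Lu) with (p := a); auto.
        intros b Hb. apply (faces_incl _ _ Hu) in Hb. specialize (dn b Hb). lra. }
    assert (0 <= INR M / INR (S M) * D).
    { apply Rmult_le_pos; [|exact HD]. apply Rmult_le_pos; [apply pos_INR|].
      left. apply Rinv_0_lt_compat, lt_0_INR. lia. }
    destruct Hp as [<-|Hp], Hq as [<-|Hq].
    + lra.
    + specialize (In_t' q Hq). lra.
    + specialize (In_t' p Hp). lra.
    + apply (IH u t'); auto; try lia. intros a b Ha Hb.
      apply H; eapply faces_incl; eauto.
Qed.

(** * Discrete Borsuk-Ulam theorem *)

Definition basis (i : nat) : nat -> R :=
  fun j => if Nat.eq_dec j i then 1 else 0.

(** A hemisphere of the boundary of the cross-polytope in [R^(k+1)]: the cone with apex the last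
    basis vector over the equator, which is the union of two antipodal hemispheres one dimension
    lower. *)
Fixpoint octahedron (k : nat) : list (list (nat -> R)) :=
  match k with
  | O => [[basis 0]]
  | S j => map (cons (basis (S j)))
             (octahedron j ++ map (map vneg) (octahedron j))
  end.

(** By the cone formula it suffices that the equator is a cycle. Both of its halves have the same
    antipodally symmetric boundary, so everything cancels modulo 2. *)
Lemma octahedron_hemispheres : hemispheres octahedron.
Proof.
  split; [now exists (basis 0)|]. induction k as [|k IH]; intros phi.
  - simpl. destruct (phi [basis 0]), (phi [vneg (basis 0)]), (phi [basis 1]);
      reflexivity.
  - change (octahedron (S (S k))) with (map (cons (basis (S (S k))))
      (octahedron (S k) ++ map (map vneg) (octahedron (S k)))).
    rewrite xsum_boundary_cons. unfold boundary at 1.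
    rewrite flat_map_app. fold (boundary (octahedron (S k))).
    fold (boundary (map (map vneg) (octahedron (S k)))).
    rewrite boundary_map, !xsum_app.
    rewrite (ceq_map (map vneg) _ _ IH), (IH _), map_app, !xsum_app.
    rewrite !xsum_map.
    rewrite (xsum_ext (fun s => phi (_ :: map vneg (map vneg s)))
      (fun s => phi (basis (S (S k)) :: s))).
    + set (x := xsum _ (octahedron k)). set (y := xsum _ (octahedron k)).
      destruct x, y; simpl; apply xorb_false_r.
    + intros s _. f_equal. f_equal. rewrite map_map.
      rewrite (map_ext _ _ vneg_involutive). apply map_id.
Qed.

Lemma octahedron_length k s : In s (octahedron k) -> length s = S k.
Proof.
  revert s. induction k as [|k IH]; simpl; intros s H.
  - now destruct H as [<-|[]].
  - apply in_map_iff in H. destruct H as [t [<- H]]. simpl. f_equal.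
    apply in_app_or in H. destruct H as [H|H]; [auto|].
    apply in_map_iff in H. destruct H as [u [<- H]]. rewrite length_map. auto.
Qed.

Lemma rsum_ext m f g :
  (forall i, (i < m)%nat -> f i = g i) -> rsum m f = rsum m g.
Proof.
  induction m as [|m IH]; simpl; intros H; [easy|].
  rewrite IH, (H m); auto.
Qed.

Lemma rsum_plus m f g : rsum m (fun i => f i + g i) = rsum m f + rsum m g.
Proof. induction m as [|m IH]; simpl; [ring|]. rewrite IH. ring. Qed.

Lemma rsum_scal m c f : rsum m (fun i => c * f i) = c * rsum m f.
Proof. induction m as [|m IH]; simpl; [ring|]. rewrite IH. ring. Qed.

Lemma rsum_opp m f : rsum m (fun i => - f i) = - rsum m f.
Proof. induction m as [|m IH]; simpl; [ring|]. rewrite IH. ring. Qed.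

Lemma rsum_minus m f g : rsum m (fun i => f i - g i) = rsum m f - rsum m g.
Proof. induction m as [|m IH]; simpl; [ring|]. rewrite IH. ring. Qed.

Lemma rsum_const m c : rsum m (fun _ => c) = INR m * c.
Proof.
  induction m as [|m IH]; simpl rsum; [simpl; ring|]. rewrite IH, S_INR. ring.
Qed.

Lemma rsum_le m f g :
  (forall i, (i < m)%nat -> f i <= g i) -> rsum m f <= rsum m g.
Proof.
  induction m as [|m IH]; simpl; intros H; [lra|].
  assert (rsum m f <= rsum m g) by auto. specialize (H m (le_n _)). lra.
Qed.

Lemma rsum_nonneg m f : (forall i, (i < m)%nat -> 0 <= f i) -> 0 <= rsum m f.
Proof.
  intros H. replace 0 with (rsum m (fun _ => 0)).
  - now apply rsum_le.
  - rewrite rsum_const. ring.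
Qed.

Lemma rsum_zero m f : (forall i, (i < m)%nat -> f i = 0) -> rsum m f = 0.
Proof.
  intros H. rewrite (rsum_ext m f (fun _ => 0) H), rsum_const. ring.
Qed.

Lemma rsum_term_le m f j :
  (forall i, (i < m)%nat -> 0 <= f i) -> (j < m)%nat -> f j <= rsum m f.
Proof.
  induction m as [|m IH]; simpl; intros H Hj; [lia|].
  assert (0 <= rsum m f) by (apply rsum_nonneg; auto).
  destruct (Nat.eq_dec j m) as [->|E]; [lra|].
  assert (f j <= rsum m f) by (apply IH; auto; lia).
  assert (0 <= f m) by auto. lra.
Qed.

Lemma Rabs_rsum m f : Rabs (rsum m f) <= rsum m (fun i => Rabs (f i)).
Proof.
  induction m as [|m IH]; simpl; [rewrite Rabs_R0; lra|].
  eapply Rle_trans; [apply Rabs_triang|]. lra.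
Qed.

Lemma rsum_exchange m n f :
  rsum m (fun i => rsum n (fun j => f i j)) =
  rsum n (fun j => rsum m (fun i => f i j)).
Proof.
  induction m as [|m IH]; simpl.
  - symmetry. now apply rsum_zero.
  - now rewrite IH, <- rsum_plus.
Qed.

Lemma rsum_basis m j f :
  (j < m)%nat -> rsum m (fun i => f i * basis j i) = f j.
Proof.
  induction m as [|m IH]; intros Hj; [lia|].
  simpl. unfold basis at 2. destruct (Nat.eq_dec m j) as [->|D].
  - rewrite rsum_zero; [ring|]. intros i Hi. unfold basis.
    destruct (Nat.eq_dec i j); [lia|ring].
  - rewrite IH by lia. ring.
Qed.

(** The functional [e] has the signs of the face as coefficients. It equals 1 on the hull of the
    face, which keeps the points of a subdivision at distance at least 1 from the origin in the
    [l^1] norm. *)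
Lemma octahedron_face N k s :
  (k <= N)%nat -> In s (octahedron k) -> exists e : nat -> R,
    (forall i, Rabs (e i) <= 1) /\
    forall p, In p s ->
      rsum (S N) (fun i => e i * p i) = 1 /\
      (forall i, Rabs (p i) <= 1) /\ (forall i, (k < i)%nat -> p i = 0).
Proof.
  intros Hk.
  assert (B : forall j i, Rabs (basis j i) <= 1).
  { intros j i. unfold basis. destruct (Nat.eq_dec i j);
      rewrite ?Rabs_R1, ?Rabs_R0; lra. }
  revert s. induction k as [|k IH]; cbn [octahedron]; intros s H.
  - destruct H as [<-|[]]. exists (fun _ => 1). split.
    + intros; rewrite Rabs_R1; lra.
    + intros p [<-|[]]. split.
      { now rewrite (rsum_basis (S N) 0 (fun _ => 1)) by lia. }
      split; [apply B|].
      intros i Hi. unfold basis. destruct (Nat.eq_dec i 0); [lia|easy].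
  - apply in_map_iff in H. destruct H as [t [<- H]].
    assert (T : exists e : nat -> R, (forall i, Rabs (e i) <= 1) /\
      forall p, In p t -> rsum (S N) (fun i => e i * p i) = 1 /\
      (forall i, Rabs (p i) <= 1) /\ (forall i, (k < i)%nat -> p i = 0)).
    { apply in_app_or in H. destruct H as [H|H]; [apply IH; auto; lia|].
      apply in_map_iff in H. destruct H as [u [<- H]].
      destruct (IH ltac:(lia) u H) as [e [He Hu]]. exists (vneg e). split.
      - intros i. unfold vneg. now rewrite Rabs_Ropp.
      - intros p Hp. apply in_map_iff in Hp. destruct Hp as [q [<- Hq]].
        destruct (Hu q Hq) as [H1 [H2 H3]]. repeat split.
        + rewrite <- H1. apply rsum_ext. intros. unfold vneg. ring.
        + intros i. unfold vneg. now rewrite Rabs_Ropp.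
        + intros i Hi. unfold vneg. rewrite H3; auto. ring. }
    destruct T as [e [He Ht]].
    (* The apex gets coefficient 1; the vertices of the base vanish in that coordinate. *)
    exists (fun i => if Nat.eq_dec i (S k) then 1 else e i). split.
    + intros i. destruct (Nat.eq_dec i (S k)); [rewrite Rabs_R1; lra|apply He].
    + intros p [<-|Hp].
      * split; [|split; [apply B|]].
        -- rewrite (rsum_basis (S N) (S k)
             (fun i => if Nat.eq_dec i (S k) then 1 else e i)) by lia.
           now destruct (Nat.eq_dec (S k) (S k)).
        -- intros i Hi. unfold basis. destruct (Nat.eq_dec i (S k)); [lia|easy].
      * destruct (Ht p Hp) as [H1 [H2 H3]]. split; [|split; [exact H2|]].
        -- rewrite <- H1. apply rsum_ext. intros i _.
           destruct (Nat.eq_dec i (S k)) as [->|]; [rewrite H3 by lia; ring|easy].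
        -- intros i Hi. apply H3. lia.
Qed.

Lemma avg_closed_linear m (e : nat -> R) c :
  avg_closed (fun p => rsum m (fun i => e i * p i) = c).
Proof.
  intros s Hs H. apply INR_length_pos in Hs. unfold bary.
  rewrite (rsum_ext _ _ (fun i => / INR (length s) * (e i * vsum s i)))
    by (intros; unfold Rdiv; ring).
  rewrite rsum_scal.
  enough (K : rsum m (fun i => e i * vsum s i) = INR (length s) * c)
    by (rewrite K; field; lra).
  clear Hs. induction s as [|p s IH].
  - simpl. rewrite rsum_zero; [ring|]. intros; unfold vsum; simpl; ring.
  - rewrite (rsum_ext _ _ (fun i => e i * p i + e i * vsum s i))
      by (intros; unfold vsum; simpl; ring).
    rewrite rsum_plus, (H p (or_introl eq_refl)), IH
      by (intros; apply H; now right).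
    simpl length. rewrite S_INR. ring.
Qed.

(** An impredicative form of the convex hull, which subdivision preserves by
    construction. *)
Definition avg_hull (l : list (nat -> R)) (w : nat -> R) : Prop :=
  forall Q, avg_closed Q -> (forall p, In p l -> Q p) -> Q w.

(** Every small simplex stays tied to an original one: [avg_hull s0] locates its vertices, and each
    round contracts the spread of every coordinate. *)
Lemma iter_subdivide r C :
  hemispheres C -> (forall k s, In s (C k) -> length s = S k) ->
  let C' := Nat.iter r subdivide C in
  hemispheres C' /\
  forall k s, In s (C' k) -> length s = S k /\
    exists s0, In s0 (C k) /\ (forall p, In p s -> avg_hull s0 p) /\
      forall i D M, (k <= M)%nat ->
        (forall p q, In p s0 -> In q s0 -> p i - q i <= D) ->
        forall p q, In p s -> In q s ->
          p i - q i <= (INR M / INR (S M)) ^ r * D.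
Proof.
  intros HC LC. induction r as [|r [IH1 IH2]]; simpl Nat.iter.
  - split; [exact HC|]. intros k s Hs. split; [auto|]. exists s.
    split; [exact Hs|]. split; [intros p Hp Q _ HQ; auto|].
    intros i D M _ H p q Hp Hq. simpl. specialize (H p q Hp Hq). lra.
  - split; [apply subdivide_hemispheres; auto; intros k s Hs;
            now apply IH2|].
    intros k s Hs. unfold subdivide in Hs.
    apply in_flat_map in Hs. destruct Hs as [t [Ht Hs]].
    destruct (IH2 k t Ht) as [Lt [s0 [H0 [Hh Hd]]]].
    split; [eapply sd_length; eauto|]. exists s0. split; [exact H0|]. split.
    + intros p Hp Q HQ HQ0. apply (sd_avg_closed Q (S k) t s); auto.
      intros q Hq. now apply (Hh q Hq).
    + intros i D M HM HD p q Hp Hq.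
      simpl pow. rewrite Rmult_assoc.
      apply (sd_spread i _ M (S k) t s); auto; try lia.
Qed.

Lemma vanishing_factor M D eps :
  0 < eps -> exists r, (INR M / INR (S M)) ^ r * D < eps.
Proof.
  intros He. assert (P : 0 < INR (S M)) by (apply lt_0_INR; lia).
  pose proof (pos_INR M) as P0.
  assert (K : Rabs (INR M / INR (S M)) < 1).
  { rewrite Rabs_pos_eq by (apply Rdiv_le_0_compat; lra).
    apply Rlt_div_l; [exact P|]. rewrite S_INR. lra. }
  destruct (pow_lt_1_zero _ K (eps / (Rabs D + 1))) as [r Hr].
  { pose proof (Rabs_pos D). apply Rdiv_lt_0_compat; lra. }
  exists r. specialize (Hr r (le_n _)).
  pose proof (Rabs_pos D) as PD.
  apply Rle_lt_trans with (Rabs ((INR M / INR (S M)) ^ r) * Rabs D).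
  - rewrite <- Rabs_mult. apply Rle_abs.
  - apply Rlt_div_r in Hr; [|lra].
    pose proof (Rabs_pos ((INR M / INR (S M)) ^ r)).
    nra.
Qed.

(** An arbitrary [G] may be unbounded, but it takes finitely many values on a given subdivision;
    their bound determines how often to subdivide in the target. *)
Lemma coordinates_bounded N (L : list (list (nat -> R))) :
  exists B, forall s p i, In s L -> In p s -> (i < N)%nat -> Rabs (p i) <= B.
Proof.
  assert (H : forall l : list (nat -> R), exists B, forall p i,
    In p l -> (i < N)%nat -> Rabs (p i) <= B).
  { induction l as [|p l [B IH]]; [now exists 0|].
    exists (Rmax B (rsum N (fun i => Rabs (p i)))). intros q i [<-|Hq] Hi.
    - eapply Rle_trans; [|apply Rmax_r].
      apply (rsum_term_le N (fun i => Rabs (p i))); auto using Rabs_pos.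
    - eapply Rle_trans; [|apply Rmax_l]. auto. }
  destruct (H (concat L)) as [B HB]. exists B. intros s p i Hs Hp Hi.
  apply HB; auto. apply in_concat. eauto.
Qed.

(** The choice depends on absolute values only, so antipodal points get the same index. The value 0
    is a default when no coordinate reaches [c]. *)
Fixpoint large_index (c : R) (N : nat) (w : nat -> R) : nat :=
  match N with
  | O => O
  | S k => if Rle_dec c (Rabs (w k)) then k else large_index c k w
  end.

Lemma large_index_spec c N w :
  (exists i, (i < N)%nat /\ c <= Rabs (w i)) ->
  (large_index c N w < N)%nat /\ c <= Rabs (w (large_index c N w)).
Proof.
  induction N as [|N IH]; simpl; intros [i [Hi Hc]]; [lia|].
  destruct (Rle_dec c (Rabs (w N))) as [H|H]; [auto|].
  destruct IH as [H1 H2]; [|auto].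
  exists i. split; [|exact Hc].
  destruct (Nat.eq_dec i N) as [->|]; [easy|lia].
Qed.

Lemma large_index_vneg c N w : large_index c N (vneg w) = large_index c N w.
Proof.
  induction N as [|N IH]; simpl; [easy|]. rewrite IH. unfold vneg.
  now rewrite (Rabs_Ropp (w N)).
Qed.

(** Only the convex hull of the values is claimed to approach [0], which is why
    [G] may be arbitrarily discontinuous. *)
Lemma discrete_borsuk_ulam N (G : (nat -> R) -> nat -> R) eps c :
  (forall p, G (vneg p) = vneg (G p)) -> 0 < eps -> 0 < c ->
  exists s w, (length s <= S N)%nat /\
    (forall p, In p s -> 1 <= rsum (S N) (fun i => Rabs (p i)) /\
       (forall i, Rabs (p i) <= 1) /\ (forall i, (N < i)%nat -> p i = 0)) /\
    (forall i p q, In p s -> In q s -> p i - q i < eps) /\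
    avg_hull (map G s) w /\ (forall i, (i < N)%nat -> Rabs (w i) < c).
Proof.
  intros HG He Hc. apply NNPP. intros Hno.
  (* The coordinates on the octahedron lie in [[-1, 1]], so their initial spread is at most 2. *)
  destruct (vanishing_factor N 2 eps He) as [r Hr].
  destruct (iter_subdivide r octahedron octahedron_hemispheres
              octahedron_length) as [HC SC].
  set (C := Nat.iter r subdivide octahedron) in *.
  set (C1 := fun k => map (map G) (C k)).
  assert (H1 : hemispheres C1) by now apply map_hemispheres.
  assert (L1 : forall k s, In s (C1 k) -> length s = S k).
  { intros k s Hs. apply in_map_iff in Hs. destruct Hs as [t [<- Ht]].
    rewrite length_map. now apply SC. }
  destruct (coordinates_bounded N (C1 N)) as [B HB].
  destruct (vanishing_factor N (2 * B) c Hc) as [r' Hr'].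
  destruct (iter_subdivide r' C1 H1 L1) as [HC' SC'].
  set (C' := Nat.iter r' subdivide C1) in *.
  assert (large : forall k s w, (k <= N)%nat -> In s (C' k) -> In w s ->
            exists i, (i < N)%nat /\ c <= Rabs (w i)).
  (* A vertex [w] with all coordinates below [c] would lie in the hull of the values on a small
     simplex [u], and [u] and [w] would be the pair assumed not to exist. *)
  { intros k s w Hk Hs Hw. apply NNPP. intros Hw'. apply Hno.
    destruct (SC' k s Hs) as [_ [t [Ht [Hh _]]]].
    apply in_map_iff in Ht. destruct Ht as [u [<- Hu]].
    destruct (SC k u Hu) as [Lu [s0 [Hs0 [Hh0 Hd0]]]].
    destruct (octahedron_face N k s0 Hk Hs0) as [e [Ee Hf]].
    exists u, w. split; [lia|]. split; [|split; [|split]].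
    - intros p Hp. specialize (Hh0 p Hp). repeat split.
      + assert (E : rsum (S N) (fun i => e i * p i) = 1).
        { apply (Hh0 _ (avg_closed_linear (S N) e 1)). intros q Hq. now apply Hf. }
        rewrite <- E. apply rsum_le. intros i _.
        eapply Rle_trans; [apply Rle_abs|]. rewrite Rabs_mult.
        rewrite <- (Rmult_1_l (Rabs (p i))) at 2.
        apply Rmult_le_compat_r; [apply Rabs_pos|apply Ee].
      + intros i. apply Rabs_le. split.
        * apply (Hh0 _ (avg_closed_ge i (-1))). intros q Hq.
          destruct (Hf q Hq) as [_ [A _]]. specialize (A i).
          apply Rabs_le_between in A. lra.
        * apply (Hh0 _ (avg_closed_le i 1)). intros q Hq.
          destruct (Hf q Hq) as [_ [A _]]. specialize (A i).
          apply Rabs_le_between in A. lra.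
      + intros i Hi.
        apply Rle_antisym.
        * apply (Hh0 _ (avg_closed_le i 0)). intros q Hq.
          destruct (Hf q Hq) as [_ [_ A]]. rewrite A by lia. lra.
        * apply (Hh0 _ (avg_closed_ge i 0)). intros q Hq.
          destruct (Hf q Hq) as [_ [_ A]]. rewrite A by lia. lra.
    - intros i p q Hp Hq. eapply Rle_lt_trans; [|exact Hr].
      apply (Hd0 i 2 N Hk); auto. intros a b Ha Hb.
      destruct (Hf a Ha) as [_ [A _]], (Hf b Hb) as [_ [A' _]].
      specialize (A i); specialize (A' i).
      apply Rabs_le_between in A, A'. lra.
    - now apply Hh.
    - intros i Hi. apply Rnot_le_lt. intros Hci. apply Hw'. eauto. }
  (* Tucker labelling: the index of a large coordinate together with its sign. *)
  set (lab := fun w : nat -> R => (large_index c N w,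
    if Rlt_dec 0 (w (large_index c N w)) then true else false)).
  destruct (complementary_pair C' N lab HC')
    as (s & w & w' & i & Hs & Hw & Hw' & E & E').
  - intros k s w Hk Hs Hw.
    destruct (large_index_spec c N w (large k s w Hk Hs Hw)) as [A1 A2].
    split; [|exact A1]. unfold lab, flip. simpl.
    rewrite large_index_vneg. f_equal. unfold vneg.
    set (x := w (large_index c N w)) in *.
    assert (x <> 0) by (intros Z; rewrite Z, Rabs_R0 in A2; lra).
    destruct (Rlt_dec 0 x), (Rlt_dec 0 (- x)); simpl; try reflexivity; lra.
  - intros s Hs. now apply SC'.
  - destruct (large_index_spec c N w (large N s w (le_n _) Hs Hw)) as [A1 A2].
    destruct (large_index_spec c N w' (large N s w' (le_n _) Hs Hw')) as [_ A2'].
    unfold lab in E, E'. injection E as E1 E2. injection E' as E1' E2'.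
    rewrite E1 in *. rewrite E1' in *.
    destruct (Rlt_dec 0 (w i)) as [P|]; [|discriminate].
    destruct (Rlt_dec 0 (w' i)) as [|P']; [discriminate|].
    rewrite Rabs_pos_eq in A2 by lra. rewrite Rabs_left1 in A2' by lra.
    destruct (SC' N s Hs) as [_ [t [Ht [_ Hd]]]].
    (* Complementary labels force a difference of at least [2 * c] in coordinate [i], whereas the
       second subdivision has made the spread smaller than [c]. *)
    assert (K : w i - w' i <= (INR N / INR (S N)) ^ r' * (2 * B)).
    { apply (Hd i (2 * B) N (le_n _)); auto. intros p q Hp Hq.
      pose proof (HB t p i Ht Hp A1) as F. pose proof (HB t q i Ht Hq A1) as F'.
      apply Rabs_le_between in F, F'. lra. }
    lra.
Qed.

(** * Hulls of unit vectors *)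

(** The points with such weights contain the entries of [l] and are closed under averages, so they
    may serve as the predicate in [avg_hull]. *)
Lemma avg_hull_weights l w :
  avg_hull l w -> exists lam : nat -> R,
    (forall j, 0 <= lam j) /\ rsum (length l) lam = 1 /\
    forall i, w i = rsum (length l) (fun j => lam j * nth j l (fun _ => 0) i).
Proof.
  intros H. apply H; clear H w.
  - intros s Hs H.
    assert (K : exists lam : nat -> R, (forall j, 0 <= lam j) /\
      rsum (length l) lam = INR (length s) /\ forall i, vsum s i =
      rsum (length l) (fun j => lam j * nth j l (fun _ => 0) i)).
    { clear Hs. induction s as [|p s IH].
      - exists (fun _ => 0). split; [intros; lra|].
        split; [now rewrite rsum_zero|]. intros i.
        rewrite rsum_zero; [easy|]. intros; ring.
      - destruct IH as [lam [L1 [L2 L3]]]; [intros; apply H; now right|].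
        destruct (H p (or_introl eq_refl)) as [mu [M1 [M2 M3]]].
        exists (fun j => mu j + lam j). split; [|split].
        + intros j. specialize (L1 j); specialize (M1 j); lra.
        + rewrite rsum_plus, L2, M2. simpl length. rewrite S_INR. ring.
        + intros i. change (p i + vsum s i = rsum (length l)
            (fun j => (mu j + lam j) * nth j l (fun _ => 0) i)).
          rewrite M3, L3, <- rsum_plus. apply rsum_ext. intros; ring. }
    apply INR_length_pos in Hs. destruct K as [lam [L1 [L2 L3]]].
    exists (fun j => / INR (length s) * lam j). split; [|split].
    + intros j. apply Rmult_le_pos; [|apply L1].
      left. now apply Rinv_0_lt_compat.
    + rewrite rsum_scal, L2. field. lra.
    + intros i. unfold bary. rewrite L3. unfold Rdiv. rewrite Rmult_comm.
      rewrite <- rsum_scal. apply rsum_ext. intros; ring.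
  - intros p Hp. destruct (In_nth _ _ (fun _ => 0) Hp) as [j [Hj E]].
    exists (basis j). split; [|split].
    + intros i. unfold basis. destruct (Nat.eq_dec i j); lra.
    + rewrite (rsum_ext _ _ (fun i => 1 * basis j i)) by (intros; ring).
      now rewrite (rsum_basis _ j (fun _ => 1)).
    + intros i.
      rewrite (rsum_ext _ _ (fun k => nth k l (fun _ => 0) i * basis j k))
        by (intros; ring).
      rewrite (rsum_basis _ j (fun k => nth k l (fun _ => 0) i)) by exact Hj.
      now rewrite E.
Qed.

(** The coface map: the increasing enumeration of the indices other than [j]. *)
Definition skip (j i : nat) : nat := if (i <? j)%nat then i else S i.

Lemma rsum_skip k j f :
  (j <= k)%nat -> rsum (S k) f = f j + rsum k (fun i => f (skip j i)).
Proof.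
  induction k as [|k IH]; intros Hj.
  - replace j with 0%nat by lia. simpl. ring.
  - destruct (Nat.eq_dec j (S k)) as [->|D].
    + change (rsum (S (S k)) f) with (rsum (S k) f + f (S k)).
      rewrite (rsum_ext _ (fun i => f (skip (S k) i)) f); [ring|].
      intros i Hi. unfold skip. now rewrite (proj2 (Nat.ltb_lt _ _) Hi).
    + change (rsum (S (S k)) f) with (rsum (S k) f + f (S k)).
      rewrite IH by lia. simpl. unfold skip at 3.
      rewrite (proj2 (Nat.ltb_ge k j)) by lia. ring.
Qed.

Lemma skip_lt k j i : (i < k)%nat -> (skip j i < S k)%nat.
Proof. unfold skip. destruct (i <? j)%nat; lia. Qed.

(** Gaussian elimination: a vector with nonzero last coordinate serves as pivot to clear that
    coordinate from the others. *)
Lemma linear_dependency m k (a : nat -> nat -> R) :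
  (m < k)%nat -> exists mu : nat -> R,
    (exists j, (j < k)%nat /\ mu j <> 0) /\
    forall i, (i < m)%nat -> rsum k (fun j => mu j * a j i) = 0.
Proof.
  revert k a. induction m as [|m IH]; intros k a Hk.
  - exists (fun _ => 1). split; [exists 0%nat; split; [exact Hk|lra]|lia].
  - destruct (classic (exists p, (p < k)%nat /\ a p m <> 0)) as [[p [Hp Hpm]]|N].
    + destruct k as [|k]; [lia|].
      destruct (IH k (fun j i => a (skip p j) i - a (skip p j) m / a p m * a p i))
        as [mu [[j [Hj Hmu]] Z]]; [lia|].
      (* The pivot gets the coefficient that cancels the last coordinate. *)
      set (nu := fun i => if (i <? p)%nat then mu i
        else if (i =? p)%nat
             then - rsum k (fun j => mu j * (a (skip p j) m / a p m))
             else mu (pred i)).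
      assert (E : forall i, nu (skip p i) = mu i).
      { intros i. unfold nu, skip. destruct (i <? p)%nat eqn:L.
        - now rewrite L.
        - apply Nat.ltb_ge in L. rewrite (proj2 (Nat.ltb_ge _ _)) by lia.
          now rewrite (proj2 (Nat.eqb_neq _ _)) by lia. }
      assert (Ep : nu p = - rsum k (fun j => mu j * (a (skip p j) m / a p m))).
      { unfold nu. now rewrite Nat.ltb_irrefl, Nat.eqb_refl. }
      exists nu. split.
      * exists (skip p j). split; [now apply skip_lt|]. now rewrite E.
      * intros i Hi. rewrite (rsum_skip k p) by lia.
        rewrite (rsum_ext k _ (fun j => mu j * a (skip p j) i))
          by (intros; now rewrite E).
        rewrite Ep. destruct (Nat.eq_dec i m) as [->|D].
        -- rewrite (rsum_ext k (fun j => mu j * (a (skip p j) m / a p m))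
             (fun j => / a p m * (mu j * a (skip p j) m)))
             by (intros; unfold Rdiv; ring).
           rewrite rsum_scal. field. exact Hpm.
        -- rewrite <- (Z i) by lia.
           rewrite (rsum_ext k (fun j => mu j * (_ - _)) (fun j =>
             mu j * a (skip p j) i -
             a p i * (mu j * (a (skip p j) m / a p m)))) by (intros; ring).
           rewrite rsum_minus, rsum_scal. ring.
    + destruct (IH k a) as [mu [H1 H2]]; [lia|]. exists mu.
      split; [exact H1|]. intros i Hi.
      destruct (Nat.eq_dec i m) as [->|D]; [|apply H2; lia].
      apply rsum_zero. intros j Hj.
      destruct (Req_dec (a j m) 0) as [->|Hne]; [ring|]. exfalso; eauto.
Qed.

Lemma argmin_on k (P : nat -> Prop) (g : nat -> R) :
  (exists j, (j < k)%nat /\ P j) ->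
  exists j, (j < k)%nat /\ P j /\ forall i, (i < k)%nat -> P i -> g j <= g i.
Proof.
  induction k as [|k IH]; intros [j [Hj HP]]; [lia|].
  destruct (classic (exists i, (i < k)%nat /\ P i)) as [H|H].
  - destruct (IH H) as [i [Hi [HPi Hmin]]].
    destruct (classic (P k)) as [Hk|Hk].
    + destruct (Rle_dec (g i) (g k)) as [L|L].
      * exists i. split; [lia|]. split; [exact HPi|]. intros l Hl HPl.
        destruct (Nat.eq_dec l k) as [->|]; [exact L|apply Hmin; auto; lia].
      * exists k. split; [lia|]. split; [exact Hk|]. intros l Hl HPl.
        destruct (Nat.eq_dec l k) as [->|]; [lra|].
        assert (g i <= g l) by (apply Hmin; auto; lia). lra.
    + exists i. split; [lia|]. split; [exact HPi|]. intros l Hl HPl.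
      destruct (Nat.eq_dec l k) as [->|]; [easy|apply Hmin; auto; lia].
  - assert (j = k) as ->.
    { destruct (Nat.eq_dec j k); [easy|]. exfalso; apply H; exists j.
      split; [lia|easy]. }
    exists k. split; [lia|]. split; [exact HP|]. intros l Hl HPl.
    destruct (Nat.eq_dec l k) as [->|]; [lra|].
    exfalso; apply H; exists l. split; [lia|easy].
Qed.

(** An additional coordinate equal to 1 turns a linear dependency into an affine one, with
    coefficients of sum zero. Moving the weights along it until one vanishes changes neither their
    sum nor the point. *)
Lemma caratheodory_step m k (v : nat -> nat -> R) (lam : nat -> R) :
  (m < k)%nat -> (forall j, (j <= k)%nat -> 0 <= lam j) -> rsum (S k) lam = 1 ->
  exists p mu, (forall j, (j < k)%nat -> 0 <= mu j) /\ rsum k mu = 1 /\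
    forall i, (i < m)%nat -> rsum (S k) (fun j => lam j * v j i) =
      rsum k (fun j => mu j * v (skip p j) i).
Proof.
  intros Hm L0 L1.
  destruct (linear_dependency (S m) (S k)
    (fun j i => if (i <? m)%nat then v j i else 1))
    as [mu [[j0 [Hj0 Hmu]] Z]]; [lia|].
  assert (S0 : rsum (S k) mu = 0).
  { rewrite <- (Z m) by lia. apply rsum_ext. intros j _.
    rewrite Nat.ltb_irrefl. ring. }
  assert (V0 : forall i, (i < m)%nat -> rsum (S k) (fun j => mu j * v j i) = 0).
  { intros i Hi. rewrite <- (Z i) by lia. apply rsum_ext. intros j _.
    now rewrite (proj2 (Nat.ltb_lt _ _) Hi). }
  assert (Pos : exists j, (j < S k)%nat /\ 0 < mu j).
  { apply NNPP. intros N. apply Hmu. apply Rle_antisym.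
    - apply Rnot_lt_le. intros H. eauto.
    - assert (K : - mu j0 <= rsum (S k) (fun j => - mu j)).
      { apply (rsum_term_le (S k) (fun j => - mu j)); [|exact Hj0].
        intros i Hi. apply Rnot_lt_le. intros H. apply N. exists i.
        split; [exact Hi|lra]. }
      rewrite rsum_opp, S0 in K. lra. }
  destruct (argmin_on (S k) (fun j => 0 < mu j) (fun j => lam j / mu j) Pos)
    as [p [Hp [Hpos Hmin]]].
  (* The smallest ratio over the positive coefficients is the largest step that keeps all weights
     nonnegative, and it annihilates the weight of [p]. *)
  set (t := lam p / mu p).
  set (nu := fun j => lam j - t * mu j).
  assert (Np : nu p = 0) by (unfold nu, t; field; lra).
  assert (Drop : forall f, rsum (S k) (fun j => nu j * f j) =
    rsum k (fun j => nu (skip p j) * f (skip p j))).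
  { intros f. rewrite (rsum_skip k p) by lia. rewrite Np. ring. }
  assert (Same : forall f, rsum (S k) (fun j => mu j * f j) = 0 ->
    rsum (S k) (fun j => nu j * f j) = rsum (S k) (fun j => lam j * f j)).
  { intros f Hf. rewrite (rsum_ext _ (fun j => nu j * f j)
      (fun j => lam j * f j - t * (mu j * f j))) by (intros; unfold nu; ring).
    rewrite rsum_minus, rsum_scal, Hf. ring. }
  exists p, (fun j => nu (skip p j)). split; [|split].
  - intros j Hj. apply (skip_lt k p) in Hj. set (q := skip p j) in *.
    unfold nu. assert (0 <= t).
    { apply Rmult_le_pos; [apply L0; lia|].
      left. now apply Rinv_0_lt_compat. }
    destruct (Rlt_dec 0 (mu q)) as [H1|H1].
    + specialize (Hmin q Hj H1). fold t in Hmin. apply Rle_div_r in Hmin; lra.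
    + assert (0 <= lam q) by (apply L0; lia). nra.
  - rewrite (rsum_ext _ _ (fun j => nu (skip p j) * 1)) by (intros; ring).
    rewrite <- (Drop (fun _ => 1)), Same.
    + transitivity (rsum (S k) lam); [|exact L1].
      apply rsum_ext. intros; ring.
    + rewrite <- S0. apply rsum_ext. intros; ring.
  - intros i Hi. rewrite <- (Drop (fun j => v j i)), Same; auto.
Qed.

Lemma inner_combination m k (lam : nat -> R) (v : nat -> nat -> R) w :
  (forall i, (i < m)%nat -> w i = rsum k (fun j => lam j * v j i)) ->
  inner m w w =
  rsum k (fun a => rsum k (fun b => lam a * lam b * inner m (v a) (v b))).
Proof.
  intros Hw. unfold inner.
  rewrite (rsum_ext m _ (fun i => rsum k (fun a => rsum k
     (fun b => lam a * lam b * (v a i * v b i))))).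
  - rewrite rsum_exchange. apply rsum_ext. intros a _.
    rewrite rsum_exchange. apply rsum_ext. intros b _. apply rsum_scal.
  - intros i Hi. rewrite Hw by exact Hi. rewrite <- rsum_scal.
    apply rsum_ext. intros a _. rewrite Rmult_comm, <- rsum_scal.
    apply rsum_ext. intros b _. ring.
Qed.

Lemma sum_of_squares_ge k (lam : nat -> R) :
  (0 < k)%nat -> rsum k lam = 1 -> / INR k <= rsum k (fun j => lam j * lam j).
Proof.
  intros Hk L1. assert (P : 0 < INR k) by now apply lt_0_INR.
  assert (K : 0 <= rsum k (fun j => (lam j - / INR k) * (lam j - / INR k))).
  { apply rsum_nonneg. intros j _. apply (Rle_0_sqr (lam j - / INR k)). }
  rewrite (rsum_ext _ _ (fun j => lam j * lam j +
    (-2 * / INR k * lam j + / INR k * / INR k))) in K by (intros; ring).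
  rewrite !rsum_plus, rsum_scal, L1, rsum_const in K.
  replace (INR k * (/ INR k * / INR k)) with (/ INR k) in K by (field; lra).
  lra.
Qed.

(** Carathéodory reduces to at most [m + 1] vectors. Then the squared norm is at least
    [beta + (1 - beta)] times the sum of the squared weights, and that sum is at least
    [1 / (m + 1)]. *)
Lemma unit_vectors_hull_norm m beta k (v : nat -> nat -> R) (lam w : nat -> R) :
  (forall j, (j < k)%nat -> inner m (v j) (v j) = 1) ->
  (forall i j, (i < k)%nat -> (j < k)%nat -> beta <= inner m (v i) (v j)) ->
  (forall j, (j < k)%nat -> 0 <= lam j) -> rsum k lam = 1 ->
  (forall i, (i < m)%nat -> w i = rsum k (fun j => lam j * v j i)) ->
  (beta * INR m + 1) / (INR m + 1) <= inner m w w.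
Proof.
  revert v lam. induction k as [|k IH]; intros v lam V1 V2 L0 L1 Hw.
  - simpl in L1. lra.
  - destruct (Compare_dec.le_lt_dec k m) as [Hk|Hk].
    + clear IH. rewrite (inner_combination m (S k) lam v w Hw).
      assert (B : beta <= 1).
      { rewrite <- (V1 0%nat) by lia. apply V2; lia. }
      (* The Gram matrix is bounded below by the matrix with 1 on the diagonal and [beta] elsewhere;
         [basis a b] is the Kronecker delta. *)
      apply Rle_trans with (rsum (S k) (fun a => rsum (S k) (fun b =>
        beta * lam a * lam b + (1 - beta) * lam a * (lam b * basis a b)))).
      * rewrite (rsum_ext (S k) _
          (fun a => beta * lam a + (1 - beta) * (lam a * lam a))).
        -- rewrite rsum_plus, !rsum_scal, L1.
           pose proof (sum_of_squares_ge (S k) lam ltac:(lia) L1) as Q.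
           assert (I : / (INR m + 1) <= / INR (S k)).
           { apply Rinv_le_contravar; [apply lt_0_INR; lia|].
             rewrite <- S_INR. apply le_INR. lia. }
           pose proof (pos_INR m).
           replace ((beta * INR m + 1) / (INR m + 1))
             with (beta * 1 + (1 - beta) * / (INR m + 1)) by (field; lra).
           apply Rplus_le_compat_l, Rmult_le_compat_l; lra.
        -- intros a Ha. rewrite rsum_plus, !rsum_scal, L1.
           rewrite (rsum_basis (S k) a lam) by exact Ha. ring.
      * apply rsum_le. intros a Ha. apply rsum_le. intros b Hb.
        assert (0 <= lam a * lam b) by (apply Rmult_le_pos; auto).
        unfold basis. destruct (Nat.eq_dec b a) as [->|D].
        -- rewrite (V1 a Ha). lra.
        -- pose proof (V2 a b Ha Hb). nra.
    + destruct (caratheodory_step m k v lam) as (p & mu & M0 & M1 & E);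
        auto; [intros; apply L0; lia|].
      apply (IH (fun j => v (skip p j)) mu); auto.
      * intros j Hj. apply V1, skip_lt, Hj.
      * intros i j Hi Hj. apply V2; apply skip_lt; auto.
      * intros i Hi. now rewrite <- E, Hw.
Qed.

(** * Medians and the deleted join of the skeleton *)

Definition above (n : nat) (x : nat -> R) (m : R) : list nat :=
  filter (fun i => if Rlt_dec m (x i) then true else false) (seq 0 n).

(** The value of rank [k] from the top, counted from 0. The second list holds the indices with
    [x i < m]; writing it with [vneg] exposes the antipodal symmetry. *)
Definition order_stat (n k : nat) (x : nat -> R) (m : R) : Prop :=
  (length (above n x m) <= k)%nat /\
  (length (above n (vneg x) (- m)) + k < n)%nat.

Lemma In_above n x m i : In i (above n x m) <-> (i < n)%nat /\ m < x i.
Proof.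
  unfold above. rewrite filter_In, in_seq.
  destruct (Rlt_dec m (x i)); intuition (try easy; lia).
Qed.

Lemma above_S n x m :
  length (above (S n) x m) =
  (length (above n x m) + if Rlt_dec m (x n) then 1 else 0)%nat.
Proof.
  unfold above. rewrite seq_S, filter_app, length_app. simpl.
  now destruct (Rlt_dec m (x n)).
Qed.

Lemma above_anti n x m m' :
  m <= m' -> (length (above n x m') <= length (above n x m))%nat.
Proof.
  intros H. induction n as [|n IH]; [easy|]. rewrite !above_S.
  destruct (Rlt_dec m (x n)), (Rlt_dec m' (x n)); lra || lia.
Qed.

Lemma order_stat_exists n k x : (k < n)%nat -> exists m, order_stat n k x m.
Proof.
  revert k. induction n as [|n IH]; intros k Hk; [lia|].
  set (a := x n).
  (* With the new coordinate [a], the answer is [a] clamped between the values of rank [k] (from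
     [hi]) and rank [k - 1] (from [lo]) of the first [n] coordinates, when these exist. *)
  assert (lo : (0 < k)%nat -> exists m, (length (above n x m) < k)%nat /\
    (length (above n (vneg x) (- m)) + k <= n)%nat).
  { intros K. destruct (IH (pred k)) as [m [H1 H2]]; [lia|]. exists m. lia. }
  assert (hi : (k < n)%nat -> exists m, order_stat n k x m) by auto.
  assert (out : forall m, order_stat (S n) k x m <->
    (length (above n x m) + (if Rlt_dec m a then 1 else 0) <= k)%nat /\
    (length (above n (vneg x) (- m)) + (if Rlt_dec a m then 1 else 0) + k
      < S n)%nat).
  { intros m. unfold order_stat. rewrite !above_S. fold a.
    replace (vneg x n) with (- a) by easy.
    destruct (Rlt_dec (- m) (- a)), (Rlt_dec a m); lra || easy. }
  destruct (Nat.eq_dec k 0) as [->|K0].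
  - destruct (Nat.eq_dec n 0) as [->|N0].
    + exists a. apply out. simpl.
      destruct (Rlt_dec a a); [lra|lia].
    + destruct hi as [m [M1 M2]]; [lia|]. destruct (Rlt_dec m a) as [L|L].
      * exists a. apply out. pose proof (above_anti n x m a ltac:(lra)).
        assert (length (above n (vneg x) (- a)) <= n)%nat.
        { unfold above. rewrite <- (length_seq n 0) at 2. apply filter_length_le. }
        destruct (Rlt_dec a a); [lra|lia].
      * exists m. apply out. destruct (Rlt_dec m a); [lra|].
        destruct (Rlt_dec a m); lia.
  - destruct lo as [m [M1 M2]]; [lia|]. destruct (Rlt_dec a m) as [L|L].
    + destruct (Nat.eq_dec k n) as [->|KN].
      * exists a. apply out.
        assert (length (above n x a) <= n)%nat.
        { unfold above. rewrite <- (length_seq n 0) at 2. apply filter_length_le. }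
        pose proof (above_anti n (vneg x) (- m) (- a) ltac:(lra)).
        destruct (Rlt_dec a a); [lra|lia].
      * destruct hi as [m' [M1' M2']]; [lia|].
        destruct (Rlt_dec m' a) as [L'|L'].
        -- exists a. apply out.
           pose proof (above_anti n x m' a ltac:(lra)).
           pose proof (above_anti n (vneg x) (- m) (- a) ltac:(lra)).
           destruct (Rlt_dec a a); [lra|lia].
        -- exists m'. apply out. destruct (Rlt_dec m' a); [lra|].
           destruct (Rlt_dec a m'); lia.
    + exists m. apply out. destruct (Rlt_dec a m); [lra|].
      destruct (Rlt_dec m a); lia.
Qed.

(** If [m' > m + eps], every index has [x i > m] or [y i < m'], but the two counts add up to less
    than [n]. With [eps = 0] this gives uniqueness, otherwise the Lipschitz bound. *)
Lemma order_stat_le n k x y m m' eps :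
  order_stat n k x m -> order_stat n k y m' ->
  (forall i, (i < n)%nat -> y i - x i <= eps) -> m' <= m + eps.
Proof.
  intros [H1 _] [_ H2] E. apply Rnot_lt_le. intros L.
  assert (K : (n <= length (above n x m) + length (above n (vneg y) (- m')))%nat).
  { clear H1 H2. induction n as [|n IH]; [lia|]. rewrite !above_S.
    specialize (IH (fun i Hi => E i (le_S _ _ Hi))).
    specialize (E n (le_n _)). unfold vneg at 2.
    destruct (Rlt_dec m (x n)), (Rlt_dec (- m') (- y n)); lra || lia. }
  lia.
Qed.

Lemma median_lt d : (d + 1 < 2 * d + 2 + 1)%nat.
Proof. lia. Qed.

Definition median (d : nat) (x : nat -> R) : R :=
  proj1_sig (constructive_indefinite_description _
    (order_stat_exists (2 * d + 2 + 1) (d + 1) x (median_lt d))).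

Lemma median_spec d x : order_stat (2 * d + 2 + 1) (d + 1) x (median d x).
Proof. unfold median. now destruct constructive_indefinite_description. Qed.

Lemma median_vneg d x : median d (vneg x) = - median d x.
Proof.
  assert (H : order_stat (2 * d + 2 + 1) (d + 1) (vneg x) (- median d x)).
  { destruct (median_spec d x) as [H1 H2]. split; [lia|].
    rewrite vneg_involutive, Ropp_involutive. lia. }
  pose proof (median_spec d (vneg x)) as K.
  assert (median d (vneg x) <= - median d x + 0)
    by (eapply order_stat_le; eauto; intros; lra).
  assert (- median d x <= median d (vneg x) + 0)
    by (eapply order_stat_le; eauto; intros; lra).
  lra.
Qed.

Lemma median_lipschitz d x y eps :
  (forall i, (i < 2 * d + 2 + 1)%nat -> Rabs (x i - y i) <= eps) ->
  Rabs (median d x - median d y) <= eps.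
Proof.
  intros H.
  assert (forall i, (i < 2 * d + 2 + 1)%nat -> - eps <= x i - y i <= eps).
  { intros i Hi. apply Rabs_le_between. auto. }
  apply Rabs_le.
  assert (median d x <= median d y + eps).
  { eapply order_stat_le; try apply median_spec. intros i Hi.
    specialize (H0 i Hi). lra. }
  assert (median d y <= median d x + eps).
  { eapply order_stat_le; try apply median_spec. intros i Hi.
    specialize (H0 i Hi). lra. }
  lra.
Qed.

(** Subtracting the median leaves at most [d + 1] positive and at most [d + 1]
    negative coordinates. This identifies the sphere of the quotient of
    [R^(2d+3)] by its diagonal with the deleted join of the [d]-skeleton. *)
Definition upper (d : nat) (z : nat -> R) : nat -> R :=
  fun i => if (i <? 2 * d + 2 + 1)%nat then Rmax (z i - median d z) 0 else 0.

Definition mass (d : nat) (z : nat -> R) : R :=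
  rsum (2 * d + 2 + 1) (upper d z).

Definition upper_point (d : nat) (z : nat -> R) : nat -> R :=
  vscal (/ mass d z) (upper d z).

Lemma upper_nonneg d z i : 0 <= upper d z i.
Proof.
  unfold upper. destruct (i <? _)%nat; [apply Rmax_r|lra].
Qed.

Lemma upper_le_mass d z i : upper d z i <= mass d z.
Proof.
  destruct (Compare_dec.le_lt_dec (2 * d + 2 + 1) i) as [H|H].
  - unfold upper at 1. rewrite (proj2 (Nat.ltb_ge _ _) H).
    apply rsum_nonneg. intros; apply upper_nonneg.
  - apply rsum_term_le; auto. intros; apply upper_nonneg.
Qed.

Lemma upper_point_in_skel d z :
  0 < mass d z -> in_skel d (2 * d + 2) (upper_point d z).
Proof.
  intros P. unfold upper_point, vscal. split; [|split; [|split]].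
  - intros i Hi. unfold upper. rewrite (proj2 (Nat.ltb_ge _ _)) by lia. ring.
  - intros i. apply Rmult_le_pos; [|apply upper_nonneg].
    left. now apply Rinv_0_lt_compat.
  - rewrite rsum_scal. fold (mass d z). field. lra.
  - exists (above (2 * d + 2 + 1) z (median d z)).
    split; [apply median_spec|]. intros i Hi. rewrite In_above in Hi.
    unfold upper. destruct (Nat.ltb_spec i (2 * d + 2 + 1)); [|ring].
    rewrite Rmax_right; [ring|]. apply Rnot_lt_le. intros K. apply Hi.
    split; [assumption|lra].
Qed.

(** The two supports are disjoint, so equality would make both points zero, against total weight
    1. *)
Lemma upper_points_distinct d z :
  0 < mass d z -> upper_point d z <> upper_point d (vneg z).
Proof.
  intros P E.
  assert (Z : forall i, upper_point d z i = 0).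
  { intros i. pose proof (f_equal (fun u => u i) E) as Ei. simpl in Ei.
    unfold upper_point, vscal in *. unfold upper in *.
    destruct (i <? _)%nat; [|ring]. rewrite median_vneg in Ei.
    unfold vneg at 2 in Ei.
    destruct (Rle_dec (z i) (median d z)) as [L|L].
    - rewrite Rmax_right by lra. ring.
    - rewrite (Rmax_right (- z i - _)) in Ei by lra. rewrite Ei. ring. }
  destruct (upper_point_in_skel d z P) as [_ [_ [S _]]].
  rewrite rsum_zero in S; [lra|]. intros; apply Z.
Qed.

Lemma upper_lipschitz d z z' eps :
  (forall i, (i < 2 * d + 2 + 1)%nat -> Rabs (z i - z' i) <= eps) ->
  forall i, Rabs (upper d z i - upper d z' i) <= 2 * eps.
Proof.
  intros H i. pose proof (median_lipschitz d z z' eps H) as M. unfold upper.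
  assert (0 <= eps).
  { eapply Rle_trans; [apply Rabs_pos|apply (H 0%nat); lia]. }
  destruct (Nat.ltb_spec i (2 * d + 2 + 1)) as [L|L];
    [|rewrite Rminus_0_r, Rabs_R0; lra].
  specialize (H i L). apply Rabs_le_between in H, M. apply Rabs_le.
  unfold Rmax. destruct (Rle_dec (z i - _) 0), (Rle_dec (z' i - _) 0); lra.
Qed.

Lemma mass_lipschitz d z z' eps :
  (forall i, (i < 2 * d + 2 + 1)%nat -> Rabs (z i - z' i) <= eps) ->
  Rabs (mass d z - mass d z') <= INR (2 * d + 2 + 1) * (2 * eps).
Proof.
  intros H. unfold mass. rewrite <- rsum_minus.
  eapply Rle_trans; [apply Rabs_rsum|]. rewrite <- rsum_const.
  apply rsum_le. intros i _. now apply upper_lipschitz.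
Qed.

Lemma upper_point_lipschitz d z z' eps c :
  (forall i, (i < 2 * d + 2 + 1)%nat -> Rabs (z i - z' i) <= eps) ->
  0 < c -> c <= mass d z -> c <= mass d z' ->
  forall i, Rabs (upper_point d z i - upper_point d z' i) <=
    (INR (2 * d + 2 + 1) + 1) * (2 * eps) / c.
Proof.
  intros H Hc C C' i. unfold upper_point, vscal.
  pose proof (upper_lipschitz d z z' eps H i) as U.
  pose proof (mass_lipschitz d z z' eps H) as M.
  pose proof (upper_nonneg d z' i) as U0. pose proof (upper_le_mass d z' i) as U1.
  set (a := mass d z) in *. set (b := mass d z') in *.
  set (u := upper d z i) in *. set (v := upper d z' i) in *.
  (* This separates the change of the coordinate from that of the mass; the factor [v / b] lies in
     [[0, 1]]. *)
  replace (/ a * u - / b * v) with (/ a * ((u - v) + v / b * (b - a)))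
    by (field; lra).
  rewrite Rabs_mult, Rabs_pos_eq by (left; apply Rinv_0_lt_compat; lra).
  unfold Rdiv at 2. rewrite Rmult_comm.
  apply Rmult_le_compat;
    [apply Rabs_pos|left; apply Rinv_0_lt_compat; lra| |
     apply Rinv_le_contravar; lra].
  eapply Rle_trans; [apply Rabs_triang|]. rewrite Rabs_mult.
  assert (V : 0 <= v / b <= 1).
  { split; [apply Rdiv_le_0_compat; lra|]. apply Rle_div_l; lra. }
  rewrite (Rabs_pos_eq (v / b)) by lra. rewrite Rabs_minus_sym in M.
  pose proof (Rabs_pos (b - a)). nra.
Qed.

(** The total mass is the sum of all [Rabs (z i - m)], with [m] the median. The vanishing last
    coordinate contributes [Rabs m], so a small mass would force a small median and then small
    coordinates. *)
Lemma mass_sum_ge d z :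
  1 <= rsum (2 * d + 2) (fun i => Rabs (z i)) -> z (2 * d + 2)%nat = 0 ->
  1 <= INR (2 * d + 2 + 1) * (mass d z + mass d (vneg z)).
Proof.
  intros H Z. unfold mass. rewrite <- rsum_plus.
  set (S := rsum _ (fun i => upper d z i + _)).
  set (m := median d z).
  assert (E : S = rsum (2 * d + 2 + 1) (fun i => Rabs (z i - m))).
  { apply rsum_ext. intros i Hi. unfold upper.
    rewrite (proj2 (Nat.ltb_lt _ _) Hi), median_vneg. fold m. unfold vneg.
    unfold Rmax, Rabs. destruct (Rle_dec (z i - m) 0),
      (Rle_dec (- z i - - m) 0), (Rcase_abs (z i - m)); lra. }
  assert (Hm : Rabs m <= S).
  { rewrite E. replace (Rabs m) with (Rabs (z (2 * d + 2)%nat - m)).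
    - apply (rsum_term_le _ (fun i => Rabs (z i - m))); [|lia].
      intros; apply Rabs_pos.
    - rewrite Z, Rminus_0_l. apply Rabs_Ropp. }
  assert (K : rsum (2 * d + 2) (fun i => Rabs (z i)) <=
              S + INR (2 * d + 2) * Rabs m).
  { apply Rle_trans with
      (rsum (2 * d + 2) (fun i => Rabs (z i - m) + Rabs m)).
    - apply rsum_le. intros i _. replace (z i) with (z i - m + m) at 1 by ring.
      apply Rabs_triang.
    - rewrite rsum_plus, rsum_const. apply Rplus_le_compat_r. rewrite E.
      rewrite Nat.add_1_r. simpl.
      pose proof (Rabs_pos (z (2 * d + 2)%nat - m)). simpl in *. lra. }
  rewrite Nat.add_1_r, S_INR. pose proof (pos_INR (2 * d + 2)). nra.
Qed.

Lemma norm_le_coordinates m w D :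
  (forall i, (i < m)%nat -> Rabs (w i) <= D) -> Defs.norm m w <= INR m * D.
Proof.
  intros H. unfold Defs.norm, inner. destruct m as [|m].
  - simpl. rewrite sqrt_0. lra.
  - assert (P : 0 <= D) by (eapply Rle_trans; [apply Rabs_pos|apply (H 0%nat); lia]).
    assert (M : 1 <= INR (S m)) by (rewrite S_INR; pose proof (pos_INR m); lra).
    rewrite <- (sqrt_Rsqr (INR (S m) * D)) by nra.
    apply sqrt_le_1_alt. apply Rle_trans with (INR (S m) * (D * D)).
    + rewrite <- rsum_const. apply rsum_le. intros i Hi.
      specialize (H i Hi). rewrite <- (Rabs_pos_eq (w i * w i)) by nra.
      rewrite Rabs_mult. pose proof (Rabs_pos (w i)).
      apply Rmult_le_compat; lra.
    + unfold Rsqr. assert (0 <= D * D) by nra. nra.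
Qed.

(** * Lebesgue numbers on the cube *)

Fixpoint vec_of_Tn (n : nat) : Tn n R -> nat -> R :=
  match n with
  | O => fun _ _ => 0
  | S k => fun x i => match i with
                      | O => fst x
                      | S j => vec_of_Tn k (snd x) j
                      end
  end.

Fixpoint Tn_of_vec (n : nat) (v : nat -> R) : Tn n R :=
  match n with
  | O => tt
  | S k => (v 0%nat, Tn_of_vec k (fun i => v (S i)))
  end.

Lemma bounded_n_vec n a b x :
  bounded_n n (Tn_of_vec n (fun _ => a)) (Tn_of_vec n (fun _ => b)) x <->
  forall i, (i < n)%nat -> a <= vec_of_Tn n x i <= b.
Proof.
  induction n as [|n IH]; simpl.
  - split; [lia|easy].
  - destruct x as [x0 x]. simpl. rewrite IH. split.
    + intros [H1 H2] [|i] Hi; [easy|apply H2; lia].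
    + intros H. split; [apply (H 0%nat); lia|].
      intros i Hi. apply (H (S i)). lia.
Qed.

Lemma close_n_vec n e x t :
  close_n n e x t <->
  forall i, (i < n)%nat -> Rabs (vec_of_Tn n x i - vec_of_Tn n t i) < e.
Proof.
  induction n as [|n IH]; simpl.
  - split; [lia|easy].
  - destruct x as [x0 x], t as [t0 t]. simpl. rewrite IH. split.
    + intros [H1 H2] [|i] Hi; [easy|apply H2; lia].
    + intros H. split; [apply (H 0%nat); lia|].
      intros i Hi. apply (H (S i)). lia.
Qed.

Lemma vec_of_Tn_of_vec n v i : (i < n)%nat -> vec_of_Tn n (Tn_of_vec n v) i = v i.
Proof.
  revert v i. induction n as [|n IH]; intros v i Hi; [lia|].
  destruct i as [|i]; simpl; [easy|]. apply (IH (fun j => v (S j))). lia.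
Qed.

Lemma vec_of_Tn_out n x i : (n <= i)%nat -> vec_of_Tn n x i = 0.
Proof.
  revert i. induction n as [|n IH]; intros i Hi; [easy|].
  destruct i as [|i]; [lia|]. simpl. apply IH. lia.
Qed.

(** Choosing a radius for each centre yields a gauge, to which [compactness_value] applies. As [P]
    is not assumed monotone in the radius, each point is returned with a centre and the radius of
    that centre. *)
Lemma cube_lebesgue n (P : (nat -> R) -> R -> Prop) :
  (forall t, (forall i, (n <= i)%nat -> t i = 0) ->
     exists r, 0 < r /\ P t r) ->
  exists eps, 0 < eps /\ forall z, (forall i, Rabs (z i) <= 1) ->
    exists t r, (forall i, (n <= i)%nat -> t i = 0) /\ P t r /\ eps <= r /\
      forall i, (i < n)%nat -> Rabs (z i - t i) < r.
Proof.
  intros H.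
  assert (H' : forall x : Tn n R, exists r : posreal, P (vec_of_Tn n x) r).
  { intros x. destruct (H (vec_of_Tn n x) (vec_of_Tn_out n x)) as [r [Hr HP]].
    now exists (mkposreal r Hr). }
  set (delta := fun x => proj1_sig (constructive_indefinite_description _ (H' x))).
  assert (Hd : forall x, P (vec_of_Tn n x) (delta x)).
  { intros x. unfold delta. now destruct constructive_indefinite_description. }
  destruct (compactness_value n (Tn_of_vec n (fun _ => -1))
    (Tn_of_vec n (fun _ => 1)) delta) as [e He].
  exists e. split; [apply cond_pos|]. intros z Hz.
  destruct (NNPP _ (He (Tn_of_vec n z) ltac:(apply bounded_n_vec; intros i Hi;
    rewrite vec_of_Tn_of_vec by exact Hi; now apply Rabs_le_between)))
    as [t [_ [Hc Hle]]].
  exists (vec_of_Tn n t), (delta t). split; [apply vec_of_Tn_out|].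
  split; [apply Hd|]. split; [exact Hle|]. intros i Hi.
  rewrite <- (vec_of_Tn_of_vec n z i Hi). now apply close_n_vec.
Qed.

(** * The direction map *)

(** Here [x] may lie outside [[-1, 1]]: above 1 the bound on [cos] suffices, and below -1 [acos x]
    is [PI], which exceeds [t]. *)
Lemma acos_le_cos x t : 0 <= t < PI -> acos x <= t -> cos t <= x.
Proof.
  intros Ht H.
  destruct (Rle_dec 1 x) as [L1|L1]; [pose proof (COS_bound t); lra|].
  destruct (Rle_dec (-1) x) as [L2|L2].
  - rewrite <- (cos_acos x) by lra. pose proof (acos_bound x).
    apply cos_decr_1; lra.
  - unfold acos in H. destruct (Rle_dec x (-1)); lra.
Qed.

Lemma inner_self_pos m w :
  (exists i, (i < m)%nat /\ w i <> 0) -> 0 < inner m w w.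
Proof.
  intros [i [Hi Hw]].
  apply Rlt_le_trans with (w i * w i); [apply (Rlt_0_sqr (w i) Hw)|].
  apply (rsum_term_le m (fun i => w i * w i)); [|exact Hi].
  intros j _. apply (Rle_0_sqr (w j)).
Qed.

Lemma inner_normalized m w :
  0 < inner m w w ->
  inner m (vscal (/ Defs.norm m w) w) (vscal (/ Defs.norm m w) w) = 1.
Proof.
  intros H. unfold inner at 1, vscal. set (c := / Defs.norm m w).
  rewrite (rsum_ext _ _ (fun i => c * c * (w i * w i))) by (intros; ring).
  rewrite rsum_scal. fold (inner m w w). unfold c, Defs.norm.
  rewrite <- (sqrt_sqrt (inner m w w)) at 3 by lra.
  field. apply Rgt_not_eq, sqrt_lt_R0, H.
Qed.

Lemma Phi_unit X m (f : X -> Rvec m) (p : Conf2 X) :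
  (forall x y, f x = f y -> x = y) -> inner m (Phi m f p) (Phi m f p) = 1.
Proof.
  intros Hf. apply inner_normalized, inner_self_pos, NNPP. intros N.
  apply (proj2_sig p), Hf. set (a := f (fst _)) in *. set (b := f (snd _)) in *.
  apply eq_sig_hprop; [intros; apply proof_irrelevance|].
  apply functional_extensionality. intros i.
  destruct (Compare_dec.le_lt_dec m i) as [L|L].
  - now rewrite (proj2_sig a i L), (proj2_sig b i L).
  - apply Rminus_diag_uniq, NNPP. intros H. apply N. now exists i.
Qed.

Definition extend_by_zero (d : nat) (f : skel d (2 * d + 2) -> Rvec (2 * d))
  (x : nat -> R) : nat -> R :=
  match excluded_middle_informative (in_skel d (2 * d + 2) x) with
  | left H => proj1_sig (f (exist _ x H))
  | right _ => fun _ => 0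
  end.

(** The value of [Phi] at the configuration of [z], made total so that it is odd even where a mass
    vanishes. *)
Definition direction (d : nat) (f : skel d (2 * d + 2) -> Rvec (2 * d))
  (z : nat -> R) : nat -> R :=
  let w := vsub (extend_by_zero d f (upper_point d z))
                (extend_by_zero d f (upper_point d (vneg z))) in
  vscal (/ Defs.norm (2 * d) w) w.

Lemma direction_vneg d f z : direction d f (vneg z) = vneg (direction d f z).
Proof.
  unfold direction. rewrite vneg_involutive.
  set (a := extend_by_zero d f (upper_point d z)).
  set (b := extend_by_zero d f (upper_point d (vneg z))).
  replace (Defs.norm (2 * d) (vsub b a)) with (Defs.norm (2 * d) (vsub a b)).
  - apply functional_extensionality. intros i.
    unfold vneg, vscal, vsub. ring.
  - unfold Defs.norm, inner. f_equal. apply rsum_ext. intros i _.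
    unfold vsub. ring.
Qed.

Definition conf_point (d : nat) (z : nat -> R)
  (H : 0 < mass d z) (H' : 0 < mass d (vneg z)) : Conf2 (skel d (2 * d + 2)) :=
  exist (fun p => fst p <> snd p)
    (exist _ (upper_point d z) (upper_point_in_skel d z H),
     exist _ (upper_point d (vneg z)) (upper_point_in_skel d (vneg z) H'))
    (fun E => upper_points_distinct d z H (f_equal (@proj1_sig _ _) E)).

Lemma Phi_conf_point d f z H H' :
  Phi (2 * d) f (conf_point d z H H') = direction d f z.
Proof.
  assert (E : forall x (Hx : in_skel d (2 * d + 2) x),
    proj1_sig (f (exist _ x Hx)) = extend_by_zero d f x).
  { intros x Hx. unfold extend_by_zero.
    destruct (excluded_middle_informative _) as [Hx'|N]; [|easy].
    now rewrite (proof_irrelevance _ Hx Hx'). }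
  unfold Phi, direction. simpl fst. simpl snd. now rewrite !E.
Qed.

(** Where both masses are at least [c], the configuration depends on [z] in a Lipschitz way, so the
    neighbourhoods [U] pull back to the cube and have a common Lebesgue number. *)
Lemma direction_uniform d f delta c :
  0 < c ->
  (forall q, exists U, conf_open d (2 * d + 2) U /\ U q /\
     Rbar_le (diam_img (2 * d) (Phi (2 * d) f) U) (Finite delta)) ->
  exists eps, 0 < eps /\ forall z z',
    (forall i, Rabs (z i) <= 1) ->
    (forall i, (2 * d + 2 <= i)%nat -> z i = 0) ->
    (forall i, (2 * d + 2 <= i)%nat -> z' i = 0) ->
    c <= mass d z -> c <= mass d (vneg z) ->
    c <= mass d z' -> c <= mass d (vneg z') ->
    (forall i, Rabs (z i - z' i) < eps) ->
    sphere_dist (2 * d) (direction d f z) (direction d f z') <= delta.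
Proof.
  intros Hc HU. set (nu := INR (2 * d + 2 + 1)).
  assert (Nu : 1 <= nu).
  { unfold nu. rewrite Nat.add_1_r, S_INR. pose proof (pos_INR (2 * d + 2)). lra. }
  assert (ext : forall z t r, (forall i, (2 * d + 2 <= i)%nat -> z i = 0) ->
    (forall i, (2 * d + 2 <= i)%nat -> t i = 0) -> 0 < r ->
    (forall i, (i < 2 * d + 2)%nat -> Rabs (z i - t i) < r) ->
    (forall i, (i < 2 * d + 2 + 1)%nat -> Rabs (t i - z i) <= r) /\
    (forall i, (i < 2 * d + 2 + 1)%nat -> Rabs (vneg t i - vneg z i) <= r)).
  { intros z t r Hz Ht Hr H.
    assert (K : forall i, (i < 2 * d + 2 + 1)%nat -> Rabs (t i - z i) <= r).
    { intros i _. destruct (Compare_dec.le_lt_dec (2 * d + 2) i) as [L|L].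
      - rewrite Hz, Ht, Rminus_0_r, Rabs_R0 by exact L. lra.
      - rewrite Rabs_minus_sym. left. auto. }
    split; [exact K|]. intros i Hi. unfold vneg.
    replace (- t i - - z i) with (- (t i - z i)) by ring.
    rewrite Rabs_Ropp. auto. }
  (* The radius is doubled because [z] is within [r] of the centre and [z'] within [eps <= r] of
     [z]. *)
  destruct (cube_lebesgue (2 * d + 2) (fun t r => forall z z',
    (forall i, (2 * d + 2 <= i)%nat -> z i = 0) ->
    (forall i, (2 * d + 2 <= i)%nat -> z' i = 0) ->
    c <= mass d z -> c <= mass d (vneg z) ->
    c <= mass d z' -> c <= mass d (vneg z') ->
    (forall i, (i < 2 * d + 2)%nat -> Rabs (z i - t i) < 2 * r) ->
    (forall i, (i < 2 * d + 2)%nat -> Rabs (z' i - t i) < 2 * r) ->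
    sphere_dist (2 * d) (direction d f z) (direction d f z') <= delta))
    as [eps [He HL]].
  - intros t Ht.
    (* If a mass at the centre is below [c / 2], a radius is chosen so small that no nearby point
       has both masses at least [c], and the property is vacuous. *)
    destruct (Rle_dec (c / 2) (mass d t)) as [M|M];
      [destruct (Rle_dec (c / 2) (mass d (vneg t))) as [M'|M']|].
    + assert (P : 0 < mass d t) by lra. assert (P' : 0 < mass d (vneg t)) by lra.
      destruct (HU (conf_point d t P P')) as [U [Uo [Uq Ud]]].
      destruct (Uo _ Uq) as [e [Ep Ue]].
      (* With this radius the Lipschitz bound for the configuration is [e / 2]. *)
      assert (R0 : 0 < e * c / (16 * nu * (nu + 1))).
      { apply Rdiv_lt_0_compat; nra. }
      exists (e * c / (16 * nu * (nu + 1))). split; [exact R0|].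
      set (r := e * c / (16 * nu * (nu + 1))) in *.
      assert (near : forall z (Q : 0 < mass d z) (Q' : 0 < mass d (vneg z)),
        (forall i, (2 * d + 2 <= i)%nat -> z i = 0) ->
        c <= mass d z -> c <= mass d (vneg z) ->
        (forall i, (i < 2 * d + 2)%nat -> Rabs (z i - t i) < 2 * r) ->
        U (conf_point d z Q Q')).
      { intros z Q Q' Hz Mz Mz' Hd.
        destruct (ext z t (2 * r) Hz Ht ltac:(lra) Hd) as [K K'].
        assert (B : nu * ((nu + 1) * (2 * (2 * r)) / (c / 2)) < e).
        { replace (nu * ((nu + 1) * (2 * (2 * r)) / (c / 2))) with (e / 2).
          - lra.
          - unfold r. field. lra. }
        apply Ue; unfold skel_dist; simpl proj1_sig.
        - eapply Rle_lt_trans; [|exact B]. apply norm_le_coordinates.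
          intros i _. apply upper_point_lipschitz; auto; lra.
        - eapply Rle_lt_trans; [|exact B]. apply norm_le_coordinates.
          intros i _. apply upper_point_lipschitz; auto; lra. }
      intros z z' Hz Hz' M1 M2 M3 M4 D1 D2.
      assert (Q1 : 0 < mass d z) by lra.
      assert (Q2 : 0 < mass d (vneg z)) by lra.
      assert (Q3 : 0 < mass d z') by lra.
      assert (Q4 : 0 < mass d (vneg z')) by lra.
      rewrite <- (Phi_conf_point d f z Q1 Q2), <- (Phi_conf_point d f z' Q3 Q4).
      refine (Rbar_le_trans (Finite _) _ (Finite delta) _ Ud).
      apply Lub_Rbar_correct. exists (conf_point d z Q1 Q2), (conf_point d z' Q3 Q4).
      repeat split; auto.
    + assert (R0 : 0 < c / (16 * nu)) by (apply Rdiv_lt_0_compat; lra).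
      exists (c / (16 * nu)). split; [exact R0|].
      intros z z' Hz _ _ M2 _ _ D _. exfalso. apply M'.
      destruct (ext z t (2 * (c / (16 * nu))) Hz Ht ltac:(lra) D)
        as [_ K].
      apply mass_lipschitz in K. fold nu in K.
      replace (nu * (2 * (2 * (c / (16 * nu))))) with (c / 4) in K by (field; lra).
      apply Rabs_le_between in K. lra.
    + assert (R0 : 0 < c / (16 * nu)) by (apply Rdiv_lt_0_compat; lra).
      exists (c / (16 * nu)). split; [exact R0|].
      intros z z' Hz _ M1 _ _ _ D _. exfalso. apply M.
      destruct (ext z t (2 * (c / (16 * nu))) Hz Ht ltac:(lra) D)
        as [K _].
      apply mass_lipschitz in K. fold nu in K.
      replace (nu * (2 * (2 * (c / (16 * nu))))) with (c / 4) in K by (field; lra).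
      apply Rabs_le_between in K. lra.
  - exists eps. split; [exact He|].
    intros z z' B Hz Hz' M1 M2 M3 M4 D.
    destruct (HL z B) as (t & r & Ht & HP & Hr & Dt).
    apply HP; auto.
    + intros i Hi. specialize (Dt i Hi). lra.
    + intros i Hi. specialize (Dt i Hi). specialize (D i).
      replace (z' i - t i) with (- (z i - z' i) + (z i - t i)) by ring.
      eapply Rle_lt_trans; [apply Rabs_triang|]. rewrite Rabs_Ropp. lra.
Qed.

(** * The test map and the contradiction *)

(** The target is [R^(2d+1)]: coordinate [2 * d] is the difference of the masses, and its repetition
    beyond that is a default. *)
Definition test_map (d : nat) (f : skel d (2 * d + 2) -> Rvec (2 * d))
  (z : nat -> R) : nat -> R :=
  fun i => if (i <? 2 * d)%nat then direction d f z i
           else mass d z - mass d (vneg z).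

Lemma test_map_vneg d f z : test_map d f (vneg z) = vneg (test_map d f z).
Proof.
  apply functional_extensionality. intros i. unfold test_map.
  rewrite direction_vneg, vneg_involutive. unfold vneg.
  destruct (i <? 2 * d)%nat; [reflexivity|ring].
Qed.

Lemma cos_r_bound d delta :
  (1 <= d)%nat -> 0 <= delta < r_ (2 * d - 1) ->
  delta < PI /\ - / INR (2 * d) < cos delta.
Proof.
  intros hd H. unfold r_ in H.
  replace (2 * d - 1 + 1)%nat with (2 * d)%nat in H by lia.
  assert (I : 1 <= INR (2 * d)) by (apply (le_INR 1); lia).
  assert (J : 0 < / INR (2 * d) <= 1).
  { split; [apply Rinv_0_lt_compat; lra|].
    rewrite <- Rinv_1. apply Rinv_le_contravar; lra. }
  replace (-1 / INR (2 * d)) with (- / INR (2 * d)) in H by (field; lra).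
  pose proof (acos_bound (- / INR (2 * d))) as A.
  split; [lra|]. rewrite <- (cos_acos (- / INR (2 * d))) by lra.
  apply cos_decreasing_1; lra.
Qed.

Lemma no_small_modulus d (f : skel d (2 * d + 2) -> Rvec (2 * d)) delta :
  (1 <= d)%nat -> (forall x y, f x = f y -> x = y) ->
  0 <= delta < r_ (2 * d - 1) ->
  ~ (forall q, exists U, conf_open d (2 * d + 2) U /\ U q /\
     Rbar_le (diam_img (2 * d) (Phi (2 * d) f) U) (Finite delta)).
Proof.
  intros hd finj Hdelta HU.
  destruct (cos_r_bound d delta hd Hdelta) as [HPI Hcos].
  assert (Im : 1 <= INR (2 * d)) by (apply (le_INR 1); lia).
  set (m := INR (2 * d)) in *. set (beta := cos delta) in *.
  set (c := (beta * m + 1) / (m + 1)).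
  assert (Hc : 0 < c).
  { apply Rdiv_lt_0_compat; [|lra].
    assert (K : - / m * m < beta * m) by (apply Rmult_lt_compat_r; lra).
    replace (- / m * m) with (-1) in K by (field; lra). lra. }
  set (nu := INR (2 * d + 2 + 1)).
  assert (Nu : 1 <= nu) by (apply (le_INR 1); lia).
  assert (Nu' : 0 < / nu) by (apply Rinv_0_lt_compat; lra).
  destruct (direction_uniform d f delta (/ nu / 4) ltac:(lra) HU)
    as [eps [He Hunif]].
  (* The mesh lets each mass vary by at most [/ nu / 8] over the simplex. Of the bounds on [w], the
     first excludes unbalanced masses, and the other two make its squared norm at most [c / 2]. *)
  destruct (discrete_borsuk_ulam (2 * d + 1) (test_map d f)
    (Rmin eps (/ nu * / nu / 16)) (Rmin (/ nu / 4) (Rmin 1 (c / (2 * m)))))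
    as (s & w & Ls & Hs & Hd & Hh & Hw).
  { apply test_map_vneg. }
  { apply Rmin_case; [exact He|nra]. }
  { repeat apply Rmin_case; try lra. apply Rdiv_lt_0_compat; lra. }
  replace (S (2 * d + 1)) with (2 * d + 2)%nat in Hs by lia.
  assert (Hclose : forall p q i, In p s -> In q s ->
    Rabs (p i - q i) < Rmin eps (/ nu * / nu / 16)).
  { intros p q i Hp Hq. pose proof (Hd i p q Hp Hq). pose proof (Hd i q p Hq Hp).
    apply Rabs_def1; lra. }
  apply avg_hull_weights in Hh. destruct Hh as [lam [L0 [L1 HW]]].
  rewrite length_map in L1, HW. set (k := length s) in *.
  set (p := fun j => nth j s (fun _ => 0)).
  assert (Hp : forall j, (j < k)%nat -> In (p j) s) by (intros; now apply nth_In).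
  assert (HW' : forall i, w i = rsum k (fun j => lam j * test_map d f (p j) i)).
  { intros i. rewrite HW. apply rsum_ext. intros j Hj. f_equal.
    rewrite (nth_indep _ _ (test_map d f (fun _ => 0)))
      by (rewrite length_map; exact Hj).
    now rewrite map_nth. }
  clear HW. set (h := fun z => mass d z - mass d (vneg z)).
  (* One mass difference of size [/ nu / 2] would give all vertices differences of the same sign and
     size at least [/ nu / 4], hence also their average [w (2 * d)]. *)
  destruct (classic (exists j, (j < k)%nat /\ / nu / 2 <= Rabs (h (p j))))
    as [[j0 [Hj0 Hbig]]|Hsmall].
  - assert (Hh : forall j, (j < k)%nat -> Rabs (h (p j) - h (p j0)) <= / nu / 4).
    { intros j Hj.
      assert (D : forall i, (i < 2 * d + 2 + 1)%nat ->
        Rabs (p j i - p j0 i) <= / nu * / nu / 16).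
      { intros i _. left. eapply Rlt_le_trans; [|apply Rmin_r]. apply Hclose; auto. }
      assert (D' : forall i, (i < 2 * d + 2 + 1)%nat ->
        Rabs (vneg (p j) i - vneg (p j0) i) <= / nu * / nu / 16).
      { intros i Hi. unfold vneg.
        replace (- p j i - - p j0 i) with (- (p j i - p j0 i)) by ring.
        rewrite Rabs_Ropp. auto. }
      apply mass_lipschitz in D, D'. fold nu in D, D'.
      replace (nu * (2 * (/ nu * / nu / 16))) with (/ nu / 8) in D, D'
        by (field; lra).
      unfold h. apply Rabs_le. apply Rabs_le_between in D, D'. lra. }
    assert (E : w (2 * d)%nat = rsum k (fun j => lam j * h (p j))).
    { rewrite HW'. apply rsum_ext. intros j _. unfold test_map.
      now rewrite Nat.ltb_irrefl. }
    specialize (Hw (2 * d)%nat ltac:(lia)).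
    assert (Hw' : Rabs (w (2 * d)%nat) < / nu / 4)
      by (eapply Rlt_le_trans; [exact Hw|apply Rmin_l]).
    apply Rabs_lt_between in Hw'.
    destruct (Rle_dec 0 (h (p j0))) as [S0|S0].
    + rewrite Rabs_pos_eq in Hbig by exact S0.
      assert (/ nu / 4 * rsum k lam <= w (2 * d)%nat).
      { rewrite E, <- rsum_scal. apply rsum_le. intros j Hj.
        specialize (Hh j Hj). apply Rabs_le_between in Hh.
        rewrite Rmult_comm. apply Rmult_le_compat_l; [apply L0|lra]. }
      rewrite L1 in *. lra.
    + rewrite Rabs_left in Hbig by lra.
      assert (w (2 * d)%nat <= - (/ nu / 4) * rsum k lam).
      { rewrite E, <- rsum_scal. apply rsum_le. intros j Hj.
        specialize (Hh j Hj). apply Rabs_le_between in Hh.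
        rewrite (Rmult_comm _ (lam j)). apply Rmult_le_compat_l; [apply L0|lra]. }
      rewrite L1 in *. lra.
  (* The masses add up to at least [/ nu] and differ by less than [/ nu / 2]. *)
  - assert (Hmass : forall j, (j < k)%nat ->
      / nu / 4 <= mass d (p j) /\ / nu / 4 <= mass d (vneg (p j))).
    { intros j Hj. destruct (Hs (p j) (Hp j Hj)) as [A1 [_ A3]].
      pose proof (mass_sum_ge d (p j) A1
        (A3 (2 * d + 2)%nat ltac:(lia))) as T. fold nu in T.
      assert (T' : / nu <= mass d (p j) + mass d (vneg (p j))).
      { apply Rmult_le_reg_l with nu; [lra|]. rewrite Rinv_r; lra. }
      assert (B : Rabs (h (p j)) < / nu / 2).
      { apply Rnot_le_lt. intros B. apply Hsmall. now exists j. }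
      unfold h in B. apply Rabs_lt_between in B. lra. }
    assert (K : c <= inner (2 * d) w w).
    { apply (unit_vectors_hull_norm (2 * d) beta k
        (fun j => direction d f (p j)) lam); auto.
      - intros j Hj. destruct (Hmass j Hj) as [M1 M2].
        rewrite <- (Phi_conf_point d f (p j) ltac:(lra) ltac:(lra)).
        now apply Phi_unit.
      - intros i j Hi Hj.
        destruct (Hmass i Hi) as [M1 M2], (Hmass j Hj) as [M3 M4].
        destruct (Hs (p i) (Hp i Hi)) as [_ [A2 A3]].
        destruct (Hs (p j) (Hp j Hj)) as [_ [_ A3']].
        apply acos_le_cos; [lra|]. apply Hunif; auto.
        + intros l Hl. apply A3. lia.
        + intros l Hl. apply A3'. lia.
        + intros l. eapply Rlt_le_trans; [|apply Rmin_l]. apply Hclose; auto.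
      - intros i Hi. rewrite HW'. apply rsum_ext. intros j _. unfold test_map.
        now rewrite (proj2 (Nat.ltb_lt _ _) Hi). }
    (* Since [Rabs (w i) <= 1], the square of [w i] is at most [Rabs (w i)]. *)
    assert (K' : inner (2 * d) w w <= m * (c / (2 * m))).
    { unfold m at 1. rewrite <- rsum_const. apply rsum_le. intros i Hi.
      specialize (Hw i ltac:(lia)).
      assert (W1 : Rabs (w i) <= 1).
      { left. eapply Rlt_le_trans; [exact Hw|].
        eapply Rle_trans; [apply Rmin_r|apply Rmin_l]. }
      assert (W2 : Rabs (w i) <= c / (2 * m)).
      { left. eapply Rlt_le_trans; [exact Hw|].
        eapply Rle_trans; [apply Rmin_r|apply Rmin_r]. }
      eapply Rle_trans; [apply Rle_abs|]. rewrite Rabs_mult.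
      pose proof (Rabs_pos (w i)). nra. }
    replace (m * (c / (2 * m))) with (c / 2) in K' by (field; lra). lra.
Qed.

Theorem theorem1p3 (d : nat) (hd : (1 <= d)%nat)
  (f : skel d (2 * d + 2) -> Rvec (2 * d))
  (finj : forall x y, f x = f y -> x = y) :
  Rbar_le (Finite (r_ (2 * d - 1))) (alpha d (2 * d + 2) (2 * d) f).
Proof.
  apply Glb_Rbar_correct. intros delta [H0 HU]. simpl.
  apply Rnot_lt_le. intros H. now apply (no_small_modulus d f delta hd finj).
Qed.
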